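(* Let $G$ be any $d$-regular Cayley graph of an infinite group $\Gamma$ with Kazhdan's property (T). There exists $\delta=\delta(G)>0$ such that if $X$ is an FIID or weak FIID site percolation on $G$, then almost surely there is at most one cluster of $X$ whose average degree is at least $(1-\delta)d$.
   Context: $G=\mathrm{Cay}(\Gamma,S)$ with $S$ a finite symmetric generating set; $o$ is the vertex of the identity. A site percolation $X$ is a random subset of $V(G)$ (element of $\{0,1\}^{V(G)}$) with $\Gamma$-invariant law. FIID: $X=F(U)$ with $U$ i.i.d. $\mathrm{Unif}[0,1]$ labels on $V(G)$ or $E(G)$ and $F$ measurable and $\Gamma$-equivariant. Weak FIID: the law of $X$ is a weak limit (product topology) of laws of FIID site percolations. Clusters are the connected components of the subgraph of $G$ induced by $X$, viewed as subsets of $V(G)$; $\mathcal C_o$ is the cluster of $o$, and $\deg_X(o)$ is the number of neighbours of $o$ in $X$. Average degree of a cluster, for infinite clusters (as usual in this subject, the statement concerns infinite clusters): let $\mathcal I$ be the $\sigma$-field generated by the events $\{\mathcal C_o\in\mathcal A\}$, $\mathcal A\subseteq\{0,1\}^{V(G)}$ Borel and $\Gamma$-invariant, under the law conditioned on $o\in X$. Then $\mathbb E[\deg_X(o)\mid\mathcal I]=\varphi(\mathcal C_o)$ for a $\Gamma$-invariant Borel function $\varphi$, and the average degree of a cluster $\mathcal C$ is $\varphi(\mathcal C)$. Almost surely it equals $\lim_N\frac1N\sum_{n<N}\deg_X(Y_n)$ for the delayed simple random walk $(Y_n)$ on the cluster (at each step choose a uniform random neighbour in $G$, move there if it is in $X$,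 otherwise stay). *)

(* Defs.v *)
From HB Require Import structures.
From mathcomp Require Import all_boot all_order all_algebra finmap sesquilinear.
From mathcomp Require Import complex.
From mathcomp Require Import all_classical all_reals all_analysis.

Set Implicit Arguments.
Unset Strict Implicit.
Unset Printing Implicit Defensive.

Import Order.TTheory GRing.Theory Num.Theory.
Import numFieldNormedType.Exports.

Local Open Scope classical_set_scope.
Local Open Scope ring_scope.

(** * Kazhdan's property (T) for a discrete group *)

(* A complex Hilbert space is a complete normed space V over R[i] whose norm
   comes from an inner product ip (linear in the first argument, conjugate
   linear in the second). *)
Definition hilbert_form (R : realType) (V : completeNormedModType R[i])
    (ip : {dot V for (@Num.conj R[i])}) : Prop :=
  forall v : V, `|v| ^+ 2 = ip v v.

(* Each rho g is onto, with inverse rho g^-1. *)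
Definition unitary_rep (R : realType) (Gamma : groupType)
    (V : completeNormedModType R[i]) (ip : {dot V for (@Num.conj R[i])})
    (rho : Gamma -> {linear V -> V}) : Prop :=
  [/\ forall v, rho 1%g v = v,
      forall g h v, rho (g * h)%g v = rho g (rho h v) &
      forall g u v, ip (rho g u) (rho g v) = ip u v].

(* (Q, eps) is a Kazhdan pair; compact subsets of a discrete group are finite. *)
Definition kazhdan_pair (R : realType) (Gamma : groupType)
    (Q : {fset Gamma}) (eps : R) : Prop :=
  forall (V : completeNormedModType R[i]) (ip : {dot V for (@Num.conj R[i])})
    (rho : Gamma -> {linear V -> V}),
    hilbert_form ip -> unitary_rep ip rho ->
    (exists v : V, v != 0 /\
       forall g, g \in Q -> `|rho g v - v| < eps%:C%C * `|v|) ->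
    exists v : V, v != 0 /\ forall g, rho g v = v.

Definition property_T (R : realType) (Gamma : groupType) : Prop :=
  exists (Q : {fset Gamma}) (eps : R), 0 < eps /\ kazhdan_pair Q eps.

(** * Cayley graphs *)

Section Cayley.
Context (Gamma : groupType).
Implicit Types (S : {fset Gamma}) (x y : Gamma).

Definition symmetric_set S : Prop := forall s, s \in S -> s^-1%g \in S.

Definition generating_set S : Prop :=
  forall H : set Gamma,
    H 1%g -> (forall x y, H x -> H y -> H (x * y)%g) ->
    (forall x, H x -> H x^-1%g) -> (forall s, s \in S -> H s) ->
    H = setT.

(* The Cayley graph is the simple graph with edges {x, x s}, so that Gamma acts
   on it by left multiplication; the identity, if it is in S, creates no loop. *)
Definition nbrs S x : {fset Gamma} :=
  [fset (x * s)%g | s in (S `\ 1%g)%fset]%fset.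

Definition adj S : rel Gamma := fun x y => y \in nbrs S x.

Definition regular_graph S (d : nat) : Prop :=
  forall x, #|` nbrs S x | = d.

Definition lmul : Gamma -> Gamma -> Gamma := fun g x => (g * x)%g.

Definition is_edge S (e : set Gamma) : Prop :=
  exists x y, adj S x y /\ e = [set x; y].

Definition edge S := {e : set Gamma | is_edge S e}.

Lemma adj_lmul S g x y : adj S x y -> adj S (lmul g x) (lmul g y).
Proof.
move=> /imfsetP[s /= sS ->]; apply/imfsetP; exists s => //=.
by rewrite /lmul mulgA.
Qed.

Lemma is_edge_lmul S g (e : set Gamma) :
  is_edge S e -> is_edge S (lmul g @` e).
Proof.
move=> [x [y [xy ->]]]; exists (lmul g x), (lmul g y).
by split; [exact: adj_lmul | rewrite image_setU !image_set1].
Qed.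

Definition edge_act S (g : Gamma) (e : edge S) : edge S :=
  exist _ (lmul g @` sval e) (is_edge_lmul g (svalP e)).

End Cayley.

(** * Product spaces and configurations *)

Definition cylinders (I : Type) d (T : measurableType d) : set (set (I -> T)) :=
  [set C | exists i (B : set T), measurable B /\ C = [set w | B (w i)]].

(* The functions I -> T with the product sigma-algebra. *)
Definition prodspace (I : Type) d (T : measurableType d) :=
  g_sigma_algebraType (@cylinders I d T).

(* {0,1}^V; for V countable (as every finitely generated group), this
   sigma-algebra is the Borel one of the product topology. *)
Definition config (V : Type) := prodspace V bool.

Lemma measurable_coord (V : Type) (x : V) :
  measurable ([set w | w x] : set (config V)).
Proof. by apply: sub_sigma_algebra; exists x, [set true]. Qed.

Definition translate (Gamma : groupType) (I T : Type)
    (act : Gamma -> I -> I) (g : Gamma) (w : I -> T) : I -> T :=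
  fun i => w (act g^-1%g i).

Section Clusters.
Context (Gamma : groupType) (S : {fset Gamma}).
Implicit Types (X C : config Gamma) (x y : Gamma).

Definition induced_adj X : rel Gamma := fun x y => [&& X x, X y & adj S x y].

(* The cluster of x; it is empty when x is not in X. *)
Definition cluster_of X x : config Gamma :=
  fun y => X x && `[< exists p, path (induced_adj X) x p /\ last x p = y >].

Definition is_cluster X C : Prop := exists x, X x /\ C = cluster_of X x.

Definition infinite_cluster X C : Prop :=
  is_cluster X C /\ infinite_set [set x | C x].

Definition degree_in X x : nat := #|` [fset y in nbrs S x | X y]%fset |.

End Clusters.

(** * FIID and weak FIID site percolations *)

Section Percolation.
Context (R : realType) (Gamma : groupType).

Definition site_percolation_law (mu : probability (config Gamma) R) : Prop :=
  forall g (A : set (config Gamma)), measurable A ->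
    mu (translate (@lmul Gamma) g @^-1` A) = mu A.

Definition iid_uniform (I : Type) d (Omega : measurableType d)
    (P : probability Omega R) (U : I -> {RV P >-> R}) : Prop :=
  (forall i (B : set R), measurable B ->
     P (U i @^-1` B) = uniform_prob (@ltr01 R) B) /\
  (forall n (i : 'I_n -> I) (B : 'I_n -> set R),
     injective i -> (forall k, measurable (B k)) ->
     P [set w | forall k, B k (U (i k) w)] =
       (\prod_(k < n) P (U (i k) @^-1` B k))%E).

Definition factor_map (I : Type) (act : Gamma -> I -> I)
    (F : prodspace I R -> config Gamma) : Prop :=
  measurable_fun setT F /\
  forall g w, F (translate act g w) = translate (@lmul Gamma) g (F w).

(* mu is the law of F(U), for i.i.d. uniform labels U indexed by I. *)
Definition fiid_law_from (I : Type) (act : Gamma -> I -> I)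
    (mu : probability (config Gamma) R) : Prop :=
  exists d (Omega : measurableType d) (P : probability Omega R)
    (U : I -> {RV P >-> R}) (F : prodspace I R -> config Gamma),
    [/\ iid_uniform U, factor_map act F &
        forall A : set (config Gamma), measurable A ->
          mu A = P [set w | A (F (fun i => U i w))]].

Definition fiid_law (S : {fset Gamma}) (mu : probability (config Gamma) R) :
    Prop :=
  fiid_law_from (@lmul Gamma) mu \/ fiid_law_from (@edge_act Gamma S) mu.

Definition weak_cvg (mu_ : nat -> probability (config Gamma) R)
    (mu : probability (config Gamma) R) : Prop :=
  forall f : {ptws Gamma -> bool} -> R,
    continuous f -> (exists M : R, forall w, `|f w| <= M) ->
    (\int[mu_ n]_w (f w)%:E)%E @[n --> \oo] --> (\int[mu]_w (f w)%:E)%E.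

(* {0,1}^Gamma is compact and metrizable, so limits of sequences suffice. *)
Definition weak_fiid_law (S : {fset Gamma})
    (mu : probability (config Gamma) R) : Prop :=
  exists mu_ : nat -> probability (config Gamma) R,
    (forall n, fiid_law S (mu_ n)) /\ weak_cvg mu_ mu.

End Percolation.

(** * The average degree of a cluster *)

(* g is a version of the conditional expectation of f given G. *)
Definition cond_expectation (R : realType) d (T : measurableType d)
    (P : probability T R) (G : set (set T)) (f g : T -> R) : Prop :=
  [/\ forall B : set R, measurable B -> G (g @^-1` B),
      P.-integrable setT (EFin \o g) &
      forall A, G A -> (\int[P]_(w in A) (g w)%:E =
                        \int[P]_(w in A) (f w)%:E)%E].

Section AverageDegree.
Context (R : realType) (Gamma : groupType) (S : {fset Gamma}).
Variable mu : probability (config Gamma) R.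

(* The law of X conditioned on o being in X (mu itself when this has
   probability 0, in which case X is almost surely empty by invariance). *)
Definition law_given_origin : probability (config Gamma) R :=
  mnormalize (mrestr mu (measurable_coord (1%g : Gamma))) mu.

Definition invariant_events : set (set (config Gamma)) :=
  [set A : set (config Gamma) | measurable A /\
     forall g (w : config Gamma), A (translate (@lmul Gamma) g w) <-> A w].

Definition cluster_sigma_field : set (set (config Gamma)) :=
  <<s [set E | exists A, invariant_events A /\
                         E = [set X | A (cluster_of S X 1%g)]] >>.

(* E[deg_X(o) | I] = phi(C_o) under the law of X conditioned on o being in X. *)
Definition average_degree (phi : config Gamma -> R) : Prop :=
  [/\ measurable_fun setT phi,
      forall g C, phi (translate (@lmul Gamma) g C) = phi C &
      cond_expectation law_given_origin cluster_sigma_field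
        (fun X => (degree_in S X 1%g)%:R)
        (fun X => phi (cluster_of S X 1%g))].

End AverageDegree.

(* Main.v *)
Require Import Defs.
From HB Require Import structures.
From mathcomp Require Import all_boot all_order all_algebra finmap sesquilinear.
From mathcomp Require Import complex ring lra.
From mathcomp Require Import all_classical all_reals all_analysis.
From mathcomp Require Import measurable_realfun.

(** Let m be the intensity measure of the clusters of X: m(B) is the expected
    number of clusters of X that belong to B, a set of configurations. It is
    invariant under Gamma ([intensity_shift]) and usually infinite. Call a
    cluster good if it is infinite and its average degree is at least
    (1 - delta) d, and let G be the set of good clusters.

    Let B be an invariant set of good clusters, and let p be the probability
    that the cluster of the identity o is in B. This is also the intensity of
    the clusters in B that contain o ([intensity_site]). Given that the cluster
    of o is in B, the mean number of neighbours of o that it misses is at most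
    delta d. So the clusters in B that contain o and miss a given vertex g have
    intensity at most |g| delta d p, with |g| the word length
    ([average_degree_separating], [intensity_separating_word]). For small delta,
    the indicator of {C in B : o in C} is therefore almost invariant in L2(m),
    and the event that the cluster of o is in B is almost invariant in L2 of the
    law of X. Property (T) is then applied to both spaces.

    - The law of X is ergodic. For factors of i.i.d. this is mixing. Property
      (T) turns it into a spectral gap that depends only on the Kazhdan pair
      ([spectral_gap]), and such an inequality passes to weak limits, which are
      therefore ergodic as well ([weak_fiid_ergodic]).
    - By the spectral gap of the law of X, an invariant set B of good clusters
      has p = 0 or p > 1/2 ([root_density_half]). Hence of two disjoint
      invariant sets of good clusters one is null for m: the restriction of m
      to G is ergodic.
    - In L2 of m restricted to G there is an almost invariant vector, hence an
      invariant one, and so an invariant set of good clusters whose intensity is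
      positive and finite ([kazhdan_invariant_set]). By ergodicity it carries
      all the good clusters, so m(G) is finite ([good_intensity_finite]).
    - The spectral gap of m on G, applied to the clusters that contain o, shows
      that they make up more than half of m(G). They have intensity at most 1,
      so m(G) < 2 ([good_intensity_lt2]).
    - The event that there are two good clusters is invariant, so it has
      probability 0 or 1. It is not 1, since the expected number of good
      clusters is m(G) < 2 ([two_good_clusters_null]).

    Property (T) speaks of complex Hilbert spaces, whereas square-integrable
    functions form a real space with a degenerate form; [kazhdan_semiHilbert]
    bridges this gap. *)

Set Implicit Arguments.
Unset Strict Implicit.
Unset Printing Implicit Defensive.

Import Order.TTheory GRing.Theory Num.Theory.
Import numFieldNormedType.Exports.

Local Open Scope classical_set_scope.
Local Open Scope ring_scope.

(** * Semi-inner products *)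
Section semi_inner_product.
Context (R : realType) (E : lmodType R) (b : E -> E -> R).
Hypothesis bC : forall x y, b x y = b y x.
Hypothesis bl : forall a x y z, b (a *: x + y) z = a * b x z + b y z.
Hypothesis b_ge0 : forall x, 0 <= b x x.

Lemma formDl x y z : b (x + y) z = b x z + b y z.
Proof. by have := bl 1 x y z; rewrite scale1r mul1r. Qed.

Lemma form0l z : b 0 z = 0.
Proof. by have := formDl 0 0 z; rewrite addr0 -[LHS]addr0 => /addrI. Qed.

Lemma formZl a x z : b (a *: x) z = a * b x z.
Proof. by have := bl a x 0 z; rewrite addr0 form0l addr0. Qed.

Lemma formNl x z : b (- x) z = - b x z.
Proof. by rewrite -scaleN1r formZl mulN1r. Qed.

Lemma formBl x y z : b (x - y) z = b x z - b y z.
Proof. by rewrite formDl formNl. Qed.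

Lemma formDr x y z : b z (x + y) = b z x + b z y.
Proof. by rewrite !(bC z) formDl. Qed.
Lemma formZr a x z : b z (a *: x) = a * b z x.
Proof. by rewrite !(bC z) formZl. Qed.
Lemma formBr x y z : b z (x - y) = b z x - b z y.
Proof. by rewrite !(bC z) formBl. Qed.
Lemma form0r z : b z 0 = 0.
Proof. by rewrite bC form0l. Qed.

Lemma form_cauchy_schwarz x y : b x y ^+ 2 <= b x x * b y y.
Proof.
have key t : 0 <= b x x - t * b x y *+ 2 + t ^+ 2 * b y y.
  have := b_ge0 (x - t *: y).
  rewrite formBl !formBr !formZl !formZr (bC y x).
  by move=> h; apply: le_trans h _; rewrite le_eqVlt; apply/orP; left; apply/eqP; ring.
(* If b y y = 0, the expression in key is affine in t and bounded below, so its
   slope b x y is zero: otherwise the t chosen here makes it equal to -1. *)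
have [y0|y0] := eqVneq (b y y) 0.
  rewrite y0 mulr0.
  have [xy0|xy0] := eqVneq (b x y) 0; first by rewrite xy0 expr0n.
  have := key ((b x x + 1) / (b x y *+ 2)).
  rewrite y0 mulr0 addr0 -mulrnAr mulfVK ?mulrn_eq0 ?negb_or//.
  by rewrite opprD addrA addrN sub0r oppr_ge0 ler10.
have ypos : 0 < b y y by rewrite lt_neqAle eq_sym y0 b_ge0.
have := key (b x y / b y y).
rewrite (_ : _ + _ = (b x x * b y y - b x y ^+ 2) / b y y); last by field.
by rewrite pmulr_lge0 ?invr_gt0// subr_ge0.
Qed.

Lemma form_triangle x y :
  Num.sqrt (b (x + y) (x + y)) <= Num.sqrt (b x x) + Num.sqrt (b y y).
Proof.
rewrite -[leRHS]ger0_norm ?addr_ge0 ?sqrtr_ge0// -sqrtr_sqr ler_wsqrtr//.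
rewrite sqrrD !sqr_sqrtr// formDl !formDr (bC y x).
rewrite -sqrtrM//.
have : b x y <= Num.sqrt (b x x * b y y).
  apply: le_trans (ler_norm _) _; rewrite -sqrtr_sqr ler_wsqrtr//.
  exact: form_cauchy_schwarz.
by move=> h; lra.
Qed.

Lemma form_nullr x y : b y y = 0 -> b x y = 0.
Proof.
move=> y0; have := form_cauchy_schwarz x y; rewrite y0 mulr0 => h.
by apply/eqP; rewrite -sqrf_eq0 eq_le h sqr_ge0.
Qed.

End semi_inner_product.

(** Square-integrable functions, before identification almost everywhere, are of
    this kind. The form may be degenerate, so the carrier need not be a
    separated normed space, and completeness is spelled out with squared
    seminorms. *)
Record semiHilbert (R : realType) := SemiHilbert {
  sh_sort :> lmodType R ;
  sh_form : sh_sort -> sh_sort -> R ;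
  sh_formC : forall x y, sh_form x y = sh_form y x ;
  sh_forml : forall a x y z,
    sh_form (a *: x + y) z = a * sh_form x z + sh_form y z ;
  sh_form_ge0 : forall x, 0 <= sh_form x x ;
  sh_complete : forall x : nat -> sh_sort,
    (forall e, 0 < e -> exists N, forall m n, (N <= m)%N -> (N <= n)%N ->
       sh_form (x m - x n) (x m - x n) < e) ->
    exists l, forall e, 0 < e -> exists N, forall n, (N <= n)%N ->
       sh_form (x n - l) (x n - l) < e }.

(** * From a degenerate real form to a complex Hilbert space *)
Section Hilbertification.
Context (R : realType) (E : semiHilbert R) (u : E).
Notation b := (@sh_form R E).
Local Notation C := R[i].

(** The functional phi stands for the vector v + i w of the complexification of
    E. Its representatives (v, w) differ by null vectors, so such functionals
    form the separated quotient, with no equivalence classes involved. Only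
    vectors orthogonal to u are kept: with u the constant function 1 this gives
    the functions of mean zero. *)
Definition represents (v w : E) (phi : E -> C) :=
  [/\ b v u = 0, b w u = 0 & forall e, phi e = (b e v +i* b e w)%C].

Definition representable : {pred (E -> C)} :=
  fun phi => `[< exists v w, represents v w phi >].

Lemma sh_formDr (x y z : E) : b x (y + z) = b x y + b x z.
Proof. by apply: formDr; [exact: sh_formC|exact: sh_forml]. Qed.
Lemma sh_formDl (x y z : E) : b (x + y) z = b x z + b y z.
Proof. by apply: formDl; exact: sh_forml. Qed.
Lemma sh_formZr a (x y : E) : b x (a *: y) = a * b x y.
Proof. by apply: formZr; [exact: sh_formC|exact: sh_forml]. Qed.
Lemma sh_formZl a (x y : E) : b (a *: x) y = a * b x y.
Proof. by apply: formZl; exact: sh_forml. Qed.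
Lemma sh_formBr (x y z : E) : b x (y - z) = b x y - b x z.
Proof. by apply: formBr; [exact: sh_formC|exact: sh_forml]. Qed.
Lemma sh_formBl (x y z : E) : b (x - y) z = b x z - b y z.
Proof. by apply: formBl; exact: sh_forml. Qed.
Lemma sh_form0r (x : E) : b x 0 = 0.
Proof. by apply: form0r; [exact: sh_formC|exact: sh_forml]. Qed.
Lemma sh_form0l (x : E) : b 0 x = 0.
Proof. by rewrite sh_formC sh_form0r. Qed.

Lemma sh_form_nullr (x y : E) : b y y = 0 -> b x y = 0.
Proof.
by apply: form_nullr; [exact: sh_formC|exact: sh_forml|exact: sh_form_ge0].
Qed.

Lemma represents_lin (a : C) v w phi v' w' psi :
  represents v w phi -> represents v' w' psi ->
  represents (complex.Re a *: v - complex.Im a *: w + v')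
             (complex.Re a *: w + complex.Im a *: v + w') (a *: phi + psi).
Proof.
move=> [vu wu h] [vu' wu' h']; split.
- by rewrite sh_formDl sh_formBl !sh_formZl vu wu vu' !mulr0 subrr addr0.
- by rewrite !sh_formDl !sh_formZl vu wu wu' !mulr0 !addr0.
move=> e; rewrite -[LHS]/(a * phi e + psi e) h h'.
case: a => x y /=; rewrite sh_formDr sh_formBr !sh_formDr !sh_formZr.
by apply/eqP; rewrite eq_complex /=; apply/andP; split; apply/eqP; ring.
Qed.

Lemma representable_submod : submod_closed representable.
Proof.
split.
  apply/asboolP; exists 0, 0; split; rewrite ?sh_form0l// => e.
  by rewrite sh_form0r.
move=> a phi psi /asboolP[v [w h]] /asboolP[v' [w' h']]; apply/asboolP.
by do 2 eexists; exact: represents_lin h h'.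
Qed.

HB.instance Definition _ :=
  GRing.isSubmodClosed.Build C (E -> C) representable representable_submod.

Record hilb := Hilb { hilb_val :> E -> C ; hilb_prop : representable hilb_val }.
HB.instance Definition _ := [isSub for hilb_val].
HB.instance Definition _ := [Choice of hilb by <:].
HB.instance Definition _ := [SubChoice_isSubLmodule of hilb by <:].

Lemma representative_exists (phi : hilb) : exists vw : E * E, represents vw.1 vw.2 phi.
Proof. by have /asboolP[v [w h]] := hilb_prop phi; exists (v, w). Qed.
Definition rep_vectors (phi : hilb) : E * E := sval (cid (representative_exists phi)).
Definition rep_re phi := (rep_vectors phi).1.
Definition rep_im phi := (rep_vectors phi).2.
Lemma rep_vectorsP phi : represents (rep_re phi) (rep_im phi) phi.
Proof. exact: (svalP (cid (representative_exists phi))). Qed.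

(** Extending phi conjugate linearly to the representative v + i w of psi gives the
    minus sign. *)
Definition hilb_ip (phi psi : hilb) : C := phi (rep_re psi) - 'i%C * phi (rep_im psi).

(** Functionals do not see null vectors, so the inner product can be computed
    with any representatives. *)
Lemma hilb_ipE (phi psi : hilb) v w v' w' : represents v w phi -> represents v' w' psi ->
  hilb_ip phi psi = ((b v v' + b w w') +i* (b w v' - b v w'))%C.
Proof.
move=> h h'; rewrite /hilb_ip; have [_ _ k'] := rep_vectorsP psi.
have e1 e : b e (rep_re psi) = b e v'.
  by have := k' e; case: h' => _ _ ->; case.
have e2 e : b e (rep_im psi) = b e w'.
  by have := k' e; case: h' => _ _ ->; case.
case: h => _ _ h; rewrite !h !(sh_formC (rep_re _)) !(sh_formC (rep_im _)) !e1 !e2.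
by apply/eqP; rewrite eq_complex /=; apply/andP; split; apply/eqP; ring.
Qed.

Lemma hilb_valD a (x y : hilb) e : (a *: x + y) e = a * x e + y e.
Proof. by []. Qed.

Lemma hilb_ip_linl psi : GRing.linear_for *%R (hilb_ip ^~ psi).
Proof.
move=> a x y; change (hilb_ip (a *: x + y) psi = a * hilb_ip x psi + hilb_ip y psi).
by rewrite /hilb_ip !hilb_valD; ring.
Qed.

Lemma hilb_ip_conj (phi psi : hilb) : hilb_ip phi psi = (hilb_ip psi phi)^*.
Proof.
rewrite (hilb_ipE (rep_vectorsP phi) (rep_vectorsP psi)).
rewrite (hilb_ipE (rep_vectorsP psi) (rep_vectorsP phi)).
apply/eqP; rewrite eq_complex /=.
rewrite !(sh_formC (rep_re psi)) !(sh_formC (rep_im psi)).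
by apply/andP; split; apply/eqP; ring.
Qed.

Lemma hilb_ip_linr phi : GRing.linear_for (@Num.conj C \; *%R) (hilb_ip phi).
Proof.
move=> a x y; rewrite hilb_ip_conj hilb_ip_linl rmorphD rmorphM /=.
by rewrite -!hilb_ip_conj.
Qed.

HB.instance Definition _ := bilinear_isBilinear.Build C hilb hilb C *%R
  (@Num.conj C \; *%R) hilb_ip (hilb_ip_linl, hilb_ip_linr).

Lemma hilb_ip_herm (x y : hilb) : hilb_ip x y = (-1) ^+ false * (hilb_ip y x)^*.
Proof. by rewrite expr0 mul1r hilb_ip_conj. Qed.

HB.instance Definition _ := isHermitianSesquilinear.Build C hilb false
  (@Num.conj C) hilb_ip hilb_ip_herm.

Definition hilb_sqnorm (phi : hilb) : R :=
  b (rep_re phi) (rep_re phi) + b (rep_im phi) (rep_im phi).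

Lemma hilb_sqnormE (phi : hilb) v w : represents v w phi -> hilb_sqnorm phi = b v v + b w w.
Proof.
move=> h; have := hilb_ipE (rep_vectorsP phi) (rep_vectorsP phi); rewrite (hilb_ipE h h).
by case.
Qed.

Lemma hilb_ip_sqnorm (phi : hilb) : hilb_ip phi phi = (hilb_sqnorm phi)%:C%C.
Proof.
rewrite (hilb_ipE (rep_vectorsP phi) (rep_vectorsP phi)) /hilb_sqnorm.
apply/eqP; rewrite eq_complex /=.
by rewrite eqxx (sh_formC (rep_im _)) subrr eqxx.
Qed.

Lemma hilb_sqnorm_ge0 phi : 0 <= hilb_sqnorm phi.
Proof. by rewrite addr_ge0 ?sh_form_ge0. Qed.

Lemma hilb_sqnorm_eq0 phi : hilb_sqnorm phi = 0 -> phi = 0.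
Proof.
move=> /eqP; rewrite paddr_eq0 ?sh_form_ge0// => /andP[/eqP z1 /eqP z2].
apply/val_inj/funext => e; transitivity (0 : C); last by [].
rewrite -[LHS]/(phi e); have [_ _ ->] := rep_vectorsP phi.
by rewrite (sh_form_nullr e z1) (sh_form_nullr e z2).
Qed.

Lemma hilb_ip_gt0 (phi : hilb) : phi != 0 -> 0 < hilb_ip phi phi.
Proof.
move=> phi0; rewrite hilb_ip_sqnorm ltcR lt_neqAle hilb_sqnorm_ge0 andbT eq_sym.
by apply: contra phi0 => /eqP /hilb_sqnorm_eq0 ->.
Qed.

HB.instance Definition _ := isDotProduct.Build C hilb hilb_ip hilb_ip_gt0.

Definition hilb_norm (phi : hilb) : C := (Num.sqrt (hilb_sqnorm phi))%:C%C.

Lemma hilb_norm_triangle x y : hilb_norm (x + y) <= hilb_norm x + hilb_norm y.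
Proof.
rewrite /hilb_norm -rmorphD lecR.
(* The squared norm is the form B on E * E, evaluated at a representative. *)
pose B (p q : E * E) := b p.1 q.1 + b p.2 q.2.
have BC p q : B p q = B q p by rewrite /B !(sh_formC p.1) !(sh_formC p.2).
have Bl a p q r : B (a *: p + q) r = a * B p r + B q r.
  by rewrite /B /= !sh_forml; ring.
have B0 p : 0 <= B p p by rewrite addr_ge0 ?sh_form_ge0.
have -> : hilb_sqnorm (x + y) = B (rep_vectors x + rep_vectors y) (rep_vectors x + rep_vectors y).
  apply: hilb_sqnormE; have := represents_lin 1 (rep_vectorsP x) (rep_vectorsP y).
  by rewrite /= !scale1r !scale0r subr0 addr0.
exact: form_triangle BC Bl B0 (rep_vectors x) (rep_vectors y).
Qed.

Lemma hilb_normZ a x : hilb_norm (a *: x) = `|a| * hilb_norm x.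
Proof.
rewrite /hilb_norm normc_def -rmorphM; congr (_%:C)%C.
rewrite -sqrtrM ?addr_ge0 ?sqr_ge0//; congr Num.sqrt.
suff /(congr1 (@complex.Re R)) : (hilb_sqnorm (a *: x))%:C%C =
  ((complex.Re a ^+ 2 + complex.Im a ^+ 2) * hilb_sqnorm x)%:C%C :> C by [].
rewrite rmorphM /= -!hilb_ip_sqnorm linearZl_LR linearZr_LR /= mulrA; congr (_ * _).
by case: a => p q; apply/eqP; rewrite eq_complex /=; apply/andP; split; apply/eqP; ring.
Qed.

Lemma hilb_norm_eq0 x : hilb_norm x = 0 -> x = 0.
Proof.
move=> /(congr1 (@complex.Re R)) /= /eqP; rewrite sqrtr_eq0 => h; apply: hilb_sqnorm_eq0.
by apply/eqP; rewrite eq_le h hilb_sqnorm_ge0.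
Qed.

HB.instance Definition _ := Lmodule_isNormed.Build C hilb hilb_norm_triangle
  hilb_normZ hilb_norm_eq0.

Lemma represents_sub v w (phi : hilb) v' w' (psi : hilb) :
  represents v w phi -> represents v' w' psi ->
  represents (v - v') (w - w') (phi - psi).
Proof.
move=> h h'; have := represents_lin (-1) h' h.
by rewrite /= oppr0 !scale0r subr0 addr0 !scaleN1r ![- _ + _]addrC.
Qed.

Lemma hilb_normE (x : hilb) : `|x| = (Num.sqrt (hilb_sqnorm x))%:C%C :> C.
Proof. by []. Qed.

Lemma sqrt_lt (a e : R) : 0 < e -> (Num.sqrt a < e) = (a < e ^+ 2).
Proof.
move=> e0; have [a0|a0] := leP 0 a; last first.
  by rewrite ltr0_sqrtr// e0; apply/esym/(lt_le_trans a0)/sqr_ge0.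
by rewrite -{1}(ger0_norm (ltW e0)) -sqrtr_sqr ltr_sqrt// exprn_gt0.
Qed.

Lemma complex_gt0 (e : C) : 0 < e -> exists2 r : R, 0 < r & e = (r%:C)%C.
Proof.
by case: e => a c; rewrite ltcE /= => /andP[/eqP -> a0]; exists a.
Qed.

(** A Cauchy filter F contains balls of radius 1 / n.+1; their centres have
    representatives that are Cauchy sequences in E, and the functional of the
    limits is the limit of F. *)
Lemma hilb_complete (F : set_system hilb) : ProperFilter F -> cauchy F -> cvg F.
Proof.
move=> FF cF.
have ex n : exists x : hilb, F (ball x ((n.+1%:R^-1 : R)%:C%C)).
  by have /cauchyP := cF; apply; rewrite ltcR invr_gt0 ltr0n.
have [x Fx] := choice ex.
have near_seq e : 0 < e -> exists N, forall m n, (N <= m)%N -> (N <= n)%N ->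
    hilb_sqnorm (x m - x n) < e.
  move=> e0; pose r := Num.sqrt e / 2.
  have r0 : 0 < r by rewrite divr_gt0// sqrtr_gt0.
  exists (Num.truncn r^-1) => m n Nm Nn.
  have [z [xz yz]] := filter_ex (filterI (Fx m) (Fx n)).
  have lt_r k : (Num.truncn r^-1 <= k)%N -> ((k.+1%:R^-1 : R)%:C%C : C) <= r%:C%C.
    move=> Nk; rewrite lecR invf_ple ?posrE//.
    apply: ltW; apply: lt_le_trans (truncnS_gt _) _.
    by rewrite ler_nat.
  have : `|x m - x n| < (Num.sqrt e)%:C%C.
    rewrite (_ : x m - x n = (x m - z) - (x n - z)); last first.
      by rewrite opprB subrKA.
    apply: le_lt_trans (ler_normB _ _) _.
    rewrite [Num.sqrt e]splitr rmorphD; apply: ltrD.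
      by move: xz; rewrite -ball_normE => /lt_le_trans; apply; exact: lt_r.
    by move: yz; rewrite -ball_normE => /lt_le_trans; apply; exact: lt_r.
  rewrite hilb_normE ltcR sqrt_lt ?sqrtr_gt0// sqr_sqrtr//.
  exact: ltW.
have sqnormB (v w : hilb) v1 v2 : represents v1 v2 w ->
    hilb_sqnorm (v - w) = b (rep_re v - v1) (rep_re v - v1) + b (rep_im v - v2) (rep_im v - v2).
  by move=> h; apply/hilb_sqnormE/represents_sub => //; exact: rep_vectorsP.
have [l1 l1P] : exists l, forall e, 0 < e -> exists N, forall n, (N <= n)%N ->
       b (rep_re (x n) - l) (rep_re (x n) - l) < e.
  apply: sh_complete => e /near_seq[N hN]; exists N => m n Nm Nn.
  apply: le_lt_trans (hN m n Nm Nn).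
  by rewrite (sqnormB _ _ _ _ (rep_vectorsP _)) lerDl sh_form_ge0.
have [l2 l2P] : exists l, forall e, 0 < e -> exists N, forall n, (N <= n)%N ->
       b (rep_im (x n) - l) (rep_im (x n) - l) < e.
  apply: sh_complete => e /near_seq[N hN]; exists N => m n Nm Nn.
  apply: le_lt_trans (hN m n Nm Nn).
  by rewrite (sqnormB _ _ _ _ (rep_vectorsP _)) lerDr sh_form_ge0.
(* The limits are still orthogonal to u, by Cauchy-Schwarz. *)
have orth (y : nat -> E) l : (forall n, b (y n) u = 0) ->
    (forall e, 0 < e -> exists N, forall n, (N <= n)%N ->
       b (y n - l) (y n - l) < e) -> b l u = 0.
  move=> yu yl; apply/eqP; apply: contraT => lu.
  have lu0 : 0 < b l u ^+ 2 by rewrite lt_neqAle eq_sym sqrf_eq0 lu sqr_ge0.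
  have uu0 : 0 < b u u + 1 by rewrite ltr_wpDl ?sh_form_ge0.
  have [N /(_ _ (leqnn N)) hN] := yl _ (divr_gt0 lu0 uu0).
  have := form_cauchy_schwarz (@sh_formC _ _) (@sh_forml _ _)
    (@sh_form_ge0 _ _) (y N - l) u.
  rewrite sh_formBl yu sub0r sqrrN leNgt => /negP[].
  apply: le_lt_trans (_ : b (y N - l) (y N - l) * (b u u + 1) < _).
    by rewrite ler_wpM2l ?sh_form_ge0// lerDl.
  by rewrite -ltr_pdivlMr.
pose phi0 : E -> C := fun e => (b e l1 +i* b e l2)%C.
have h0 : represents l1 l2 phi0.
  split => //.
    by apply: orth l1P => n; case: (rep_vectorsP (x n)).
  by apply: orth l2P => n; case: (rep_vectorsP (x n)).
have r0 : representable phi0 by apply/asboolP; exists l1, l2.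
pose phi : hilb := Hilb r0.
apply/cvg_ex; exists phi; apply/cvgrPdist_lt => _ /complex_gt0[e e0 ->].
have e4 : 0 < (e / 2) ^+ 2 / 2 by rewrite divr_gt0// exprn_gt0// divr_gt0.
have [N1 hN1] := l1P _ e4; have [N2 hN2] := l2P _ e4.
pose n := maxn (maxn N1 N2) (Num.truncn (e / 2)^-1).
have xphi : `|x n - phi| < (e / 2)%:C%C.
  rewrite hilb_normE ltcR sqrt_lt ?divr_gt0// (sqnormB _ _ l1 l2)//.
  rewrite [ltRHS]splitr ltrD//.
    by apply: hN1; rewrite !leq_max leqnn.
  by apply: hN2; rewrite !leq_max leqnn orbT.
apply: filterS (Fx n) => z; rewrite -ball_normE /= => xz.
rewrite (_ : phi - z = (x n - z) - (x n - phi)); last first.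
  by rewrite opprB [RHS]addrC subrKA.
apply: le_lt_trans (ler_normB _ _) _.
rewrite [e]splitr rmorphD; apply: ltrD => //.
apply: lt_le_trans xz _; rewrite lecR invf_ple ?posrE ?divr_gt0//.
apply: ltW; apply: lt_le_trans (truncnS_gt _) _.
by rewrite ler_nat ltnS leq_max leqnn orbT.
Qed.

HB.instance Definition _ := Uniform_isComplete.Build hilb hilb_complete.

Lemma hilb_hilbert_form : hilbert_form (hilb_ip : {dot hilb for @Num.conj C}).
Proof.
move=> v; rewrite [RHS]hilb_ip_sqnorm hilb_normE -rmorphXn /= sqr_sqrtr//.
exact: hilb_sqnorm_ge0.
Qed.

Section representation.
Context (Gamma : groupType) (a : Gamma -> E -> E).
Hypothesis a1 : forall x, a 1%g x = x.
Hypothesis aM : forall g h x, a (g * h)%g x = a g (a h x).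
Hypothesis a_iso : forall g x y, b (a g x) (a g y) = b x y.
Hypothesis au : forall g x, b x (a g u) = b x u.

Lemma a_adj g x y : b (a g^-1%g x) y = b x (a g y).
Proof. by rewrite -(a_iso g) -aM mulgV a1. Qed.

Lemma represents_act g v w phi : represents v w phi ->
  represents (a g v) (a g w) (fun e => phi (a g^-1%g e)).
Proof.
move=> [vu wu h]; split; rewrite -?(au g) ?a_iso// => e.
by rewrite h !a_adj.
Qed.

Lemma hilb_act_subproof g (phi : hilb) : representable (fun e => phi (a g^-1%g e)).
Proof.
by apply/asboolP; do 2 eexists; exact: represents_act (rep_vectorsP phi).
Qed.

Definition hilb_act g (phi : hilb) : hilb := Hilb (hilb_act_subproof g phi).

Lemma represents_hilb_act g v w (phi : hilb) : represents v w phi ->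
  represents (a g v) (a g w) (hilb_act g phi).
Proof. exact: represents_act. Qed.

Lemma hilb_act_linear g : linear (hilb_act g).
Proof. by move=> c x y; apply: val_inj. Qed.

HB.instance Definition _ g := GRing.isLinear.Build C hilb hilb *:%R (hilb_act g)
  (hilb_act_linear g).

Lemma hilb_act_unitary :
  unitary_rep (hilb_ip : {dot hilb for @Num.conj C})
    (fun g => hilb_act g : {linear hilb -> hilb}).
Proof.
split.
- move=> v; apply/val_inj/funext => e /=.
  by rewrite invg1 a1.
- move=> g h v; apply/val_inj/funext => e /=.
  by rewrite invgM aM.
move=> g x y; rewrite -[LHS]/(hilb_ip (hilb_act g x) (hilb_act g y)) -[RHS]/(hilb_ip x y).
rewrite (hilb_ipE (represents_hilb_act g (rep_vectorsP x))
  (represents_hilb_act g (rep_vectorsP y))).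
by rewrite (hilb_ipE (rep_vectorsP x) (rep_vectorsP y)) !a_iso.
Qed.

(** The invariant vector given by property (T) is of the form v + i w, where v
    and w are both invariant and at least one of them is not null. *)
Lemma kazhdan_semiHilbert (Q : {fset Gamma}) (eps : R) (x : E) :
  0 < eps -> kazhdan_pair Q eps -> b x u = 0 -> 0 < b x x ->
  (forall g, g \in Q -> b (a g x - x) (a g x - x) < eps ^+ 2 * b x x) ->
  exists v, [/\ b v u = 0, 0 < b v v &
    forall g, b (a g v - v) (a g v - v) = 0].
Proof.
move=> eps0 kp xu x0 xQ.
have rx : representable (fun e => (b e x +i* b e 0)%C).
  by apply/asboolP; exists x, 0; split => //; rewrite sh_form0l.
have hx : represents x 0 (Hilb rx) by split => //; rewrite sh_form0l.
have sqnorm_actB g (phi : hilb) v w : represents v w phi ->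
    hilb_sqnorm (hilb_act g phi - phi) = b (a g v - v) (a g v - v) + b (a g w - w) (a g w - w).
  by move=> h; apply/hilb_sqnormE/represents_sub => //; exact: represents_hilb_act.
have [|phi [phi0 phiinv]] := kp hilb hilb_ip (fun g => hilb_act g : {linear hilb -> hilb})
  hilb_hilbert_form hilb_act_unitary.
  exists (Hilb rx); split.
    apply/eqP => /(congr1 hilb_sqnorm); rewrite (hilb_sqnormE hx) sh_form0r addr0.
    rewrite (@hilb_sqnormE 0 0 0); first by rewrite sh_form0r addr0 => x00; rewrite x00 ltxx in x0.
    by split; rewrite ?sh_form0l// => e; rewrite sh_form0r.
  move=> g gQ; rewrite !hilb_normE -rmorphM ltcR.
  rewrite (sqnorm_actB _ _ _ _ hx) (hilb_sqnormE hx) sh_form0r addr0.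
  have -> : b (a g 0 - 0) (a g 0 - 0) = 0.
    by rewrite subr0 a_iso sh_form0r.
  rewrite addr0 sqrt_lt ?mulr_gt0 ?sqrtr_gt0//.
  by rewrite exprMn sqr_sqrtr ?(ltW x0)//; exact: xQ.
have inv0 g : b (a g (rep_re phi) - rep_re phi) (a g (rep_re phi) - rep_re phi) +
    b (a g (rep_im phi) - rep_im phi) (a g (rep_im phi) - rep_im phi) = 0.
  rewrite -(sqnorm_actB _ _ _ _ (rep_vectorsP phi)) phiinv subrr.
  rewrite (@hilb_sqnormE 0 0 0); first by rewrite sh_form0r addr0.
  by split; rewrite ?sh_form0l// => e; rewrite sh_form0r.
have inv1 g : b (a g (rep_re phi) - rep_re phi) (a g (rep_re phi) - rep_re phi) = 0.
  have /eqP := inv0 g; rewrite paddr_eq0 ?sh_form_ge0// => /andP[/eqP + _].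
  by [].
have inv2 g : b (a g (rep_im phi) - rep_im phi) (a g (rep_im phi) - rep_im phi) = 0.
  have /eqP := inv0 g; rewrite paddr_eq0 ?sh_form_ge0// => /andP[_ /eqP].
  by [].
have [p1 p2 _] := rep_vectorsP phi.
have [h1|h1] := eqVneq (b (rep_re phi) (rep_re phi)) 0; last first.
  by exists (rep_re phi); split => //; rewrite lt_neqAle eq_sym h1 sh_form_ge0.
have [h2|h2] := eqVneq (b (rep_im phi) (rep_im phi)) 0; last first.
  by exists (rep_im phi); split => //; rewrite lt_neqAle eq_sym h2 sh_form_ge0.
by move/eqP: phi0; case; apply: hilb_sqnorm_eq0; rewrite /hilb_sqnorm h1 h2 addr0.
Qed.

End representation.

End Hilbertification.

(** * Square-integrable functions *)
Section L2.
Context d (T : measurableType d) (R : realType).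
Variable mu : {measure set T -> \bar R}.

Lemma le1_2 : (1%:E <= 2%:E :> \bar R)%E.
Proof. by rewrite lee_fin ler1n. Qed.

Definition L2 := LfunType mu le1_2.

Lemma L2_measurable (f : L2) : measurable_fun setT f.
Proof. by []. Qed.

Lemma L2_integrableM (f g : L2) : mu.-integrable setT (EFin \o (f \* g)).
Proof.
by apply/Lfun1_integrable; apply: Lfun2_mul_Lfun1; exact: LfunP.
Qed.

Lemma L2_lty (f : L2) : (\int[mu]_x (f x ^+ 2)%:E < +oo)%E.
Proof.
have /integrableP[_] := Lfun2_integrable_sqr (LfunP f).
apply: le_lt_trans; rewrite le_eqVlt; apply/orP; left; apply/eqP.
by apply: eq_integral => x _ /=; rewrite ger0_norm ?sqr_ge0.
Qed.

Lemma mem_L2 (f : T -> R) : measurable_fun setT f ->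
  (\int[mu]_x (f x ^+ 2)%:E < +oo)%E -> f \in Lfun mu 2%:E.
Proof.
move=> mf lf; rewrite inE; apply/andP; split; rewrite inE//=.
rewrite /finite_norm unlock; apply: poweR_lty.
rewrite (eq_integral (fun x => (f x ^+ 2)%:E))// => x _ /=.
by rewrite powR_mulrn// real_normK// num_real.
Qed.

Definition l2 f mf lf : L2 := Lfun_Sub le1_2 (@mem_L2 f mf lf).

Definition l2form (f g : L2) : R := \int[mu]_x (f x * g x).

Lemma l2formC f g : l2form f g = l2form g f.
Proof. by apply: eq_Rintegral => x _; rewrite mulrC. Qed.

Lemma l2form_lin a f g h : l2form (a *: f + g) h = a * l2form f h + l2form g h.
Proof.
rewrite /l2form -RintegralZl//; last exact: L2_integrableM.
rewrite -RintegralD//.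
- by apply: eq_Rintegral => x _; rewrite -[(a *: f + g) x]/(a * f x + g x) mulrDl mulrA.
- have h1 := L2_integrableM f h.
  exact: (integrableZl measurableT a h1).
- exact: L2_integrableM.
Qed.

Lemma l2form_ge0 f : 0 <= l2form f f.
Proof. by apply: Rintegral_ge0 => x _; rewrite -expr2 sqr_ge0. Qed.

Lemma l2formE f : (l2form f f)%:E = (\int[mu]_x (f x ^+ 2)%:E)%E.
Proof.
rewrite /l2form /Rintegral fineK; last first.
  by apply: integrable_fin_num => //; exact: L2_integrableM.
by apply: eq_integral => x _; rewrite expr2.
Qed.

(** Fatou's lemma as lower semicontinuity of the L2 seminorm. *)
Lemma l2_Fatou (f : T -> R) (g : nat -> T -> R) (A : set T) (e : R) :
  measurable A -> mu (~` A) = 0%E -> measurable_fun setT f ->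
  (forall k, measurable_fun setT (g k)) ->
  (forall x, A x -> g k x @[k --> \oo] --> f x) ->
  (\forall k \near \oo, (\int[mu]_x ((g k x) ^+ 2)%:E <= e%:E)%E) ->
  (\int[mu]_x ((f x) ^+ 2)%:E <= e%:E)%E.
Proof.
move=> mA A0 mf mg gf [N _ hN].
have mA' : measurable (~` A) by exact: measurableC.
have msq (u : T -> R) : measurable_fun setT u ->
    measurable_fun setT (fun x => (u x ^+ 2)%:E : \bar R).
  by move=> mu_; apply/measurable_EFinP; exact: measurable_funX.
have sq0 (u : T -> R) (D : set T) x : D x -> (0 <= (u x ^+ 2)%:E)%E.
  by move=> _; rewrite lee_fin sqr_ge0.
rewrite (ge0_negligible_integral mA' measurableT (msq _ mf) (sq0 f _) A0).
rewrite setTD setCK.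
rewrite (eq_integral (fun x => limn_einf (fun k => (g (N + k)%N x ^+ 2)%:E))); last first.
  move=> x; rewrite inE => Ax.
  suff /cvg_limn_einf_sup[-> _] :
    (g (N + k)%N x ^+ 2)%:E @[k --> \oo] --> (f x ^+ 2)%:E by [].
  have gN : g (N + k)%N x @[k --> \oo] --> f x.
    rewrite (eq_cvg _ _ (fun k => congr1 (g^~ x) (addnC N k))).
    by rewrite (cvg_shiftn N (g^~ x)); exact: gf.
  apply: cvg_EFin; first exact: nearW.
  by rewrite /comp /= expr2; under eq_fun do rewrite expr2; exact: cvgM.
have step k : (\int[mu]_(x in A) (g (N + k)%N x ^+ 2)%:E <= e%:E)%E.
  apply: le_trans (hN (N + k)%N (leq_addr _ _)).
  by apply: ge0_subset_integral => //; [exact: msq|exact: sq0].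
apply: le_trans (fatou mu mA _ _) _.
- by move=> k; apply: measurable_funS (msq _ (mg _)).
- by move=> k; exact: sq0.
rewrite limn_einf_lim; apply: lime_le; first exact: is_cvg_einfs.
apply: nearW => n; apply: le_trans (step n).
by apply: ereal_inf_lbound; exists n => //=.
Qed.

Lemma l2_val_sub (f g : L2) y : (f - g) y = f y - g y.
Proof. by []. Qed.

(** Riesz-Fischer. Along a fast subsequence g the series of
    4^k (g k.+1 - g k)^2 has finite integral, hence converges almost everywhere.
    There the increments of g are of order 2^-k, so g converges pointwise, and
    Fatou's lemma identifies the pointwise limit as the limit in L2. *)
Lemma L2_complete (x : nat -> L2) :
  (forall e, 0 < e -> exists N, forall m n, (N <= m)%N -> (N <= n)%N ->
     l2form (x m - x n) (x m - x n) < e) ->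
  exists l, forall e, 0 < e -> exists N, forall n, (N <= n)%N ->
     l2form (x n - l) (x n - l) < e.
Proof.
(* Once the weight 4 ^+ k is put on the increments, w k leaves 2 ^- k.+1. *)
move=> cx; pose w k : R := (4 ^+ k * 2 ^+ k.+1)^-1.
have w0 k : 0 < w k by rewrite invr_gt0 mulr_gt0// exprn_gt0.
have [N hN] := choice (fun k => cx _ (w0 k)).
pose nn k := (k + \sum_(i < k.+1) N i)%N.
have nnN k m : (k <= m)%N -> (N k <= nn m)%N.
  move=> km; apply: (leq_trans _ (leq_addl _ _)).
  by rewrite (bigD1 (Ordinal (km : (k < m.+1)%N)))//= leq_addr.
pose g k := x (nn k); pose D k := g k.+1 - g k.
have Dw k : (\int[mu]_y (D k y ^+ 2)%:E <= (w k)%:E)%E.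
  by rewrite -l2formE lee_fin ltW//; apply: hN; apply: nnN.
pose t k y : \bar R := (4 ^+ k * D k y ^+ 2)%:E.
have t0 k y : (0 <= t k y)%E by rewrite /t lee_fin mulr_ge0 ?sqr_ge0 ?exprn_ge0.
have mt k : measurable_fun setT (t k).
  apply/measurable_EFinP/measurable_funM => //.
  by apply: measurable_funX; exact: L2_measurable.
pose S y := (\sum_(k <oo) t k y)%E.
have S0 y : (0 <= S y)%E by exact: nneseries_ge0.
have mS : measurable_fun setT S by exact: ge0_emeasurable_sum.
have IS : (\int[mu]_y S y < +oo)%E.
  rewrite integral_nneseries//.
  have /cvg_lim/= := @cvg_geometric_eseries_half R 1 0.
  move=> /(_ (@ereal_hausdorff R)).
  have le_half k : (\int[mu]_y t k y <= ((1 / (2 ^ (k + 1))%:R) : R)%:E)%E.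
    have -> : (\int[mu]_y t k y = (4 ^+ k)%:E * \int[mu]_y (D k y ^+ 2)%:E)%E.
      rewrite -ge0_integralZl_EFin//.
      - by move=> y _; rewrite lee_fin sqr_ge0.
      - by apply/measurable_EFinP/measurable_funX; exact: L2_measurable.
    apply: le_trans (_ : (4 ^+ k)%:E * (w k)%:E <= _)%E.
      by rewrite lee_wpmul2l ?lee_fin ?exprn_ge0.
    rewrite -EFinM lee_fin /w invfM mulrA divff ?expf_neq0//.
    by rewrite natrX addn1.
  move=> h; apply: (@le_lt_trans _ _ 1%E); last by rewrite ltry.
  have -> : 1%E = ((1 / 2 ^+ 0) : R)%:E by rewrite expr0 divr1.
  rewrite -h; apply: lee_nneseries => k _.
    by move=> _; exact: integral_ge0.
  exact: le_half.
pose A := [set y | (S y < +oo)%E].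
have mA : measurable A.
  by rewrite /A -[X in measurable X]setTI; exact: emeasurable_fun_infty_o.
have A0 : mu (~` A) = 0%E.
  have iS : mu.-integrable setT S.
    apply/integrableP; split => //.
    by under eq_integral do rewrite gee0_abs//.
  have [B [mB B0 AB]] := integrable_ae measurableT iS.
  apply: (subset_measure0 _ mB _ B0); first exact: measurableC.
  move=> y /= yA; apply: AB => /= /(_ I); rewrite ge0_fin_numE//.
have Acvg y : A y -> cvgn (fun k => g k y).
  move=> Ay; have Sf : S y \is a fin_num by rewrite ge0_fin_numE.
  pose M := fine (S y).
  have DM k : 4 ^+ k * D k y ^+ 2 <= M.
    rewrite -lee_fin fineK//.
    have := @nneseries_lim_ge R (t ^~ y) xpredT 0%N k.+1 (fun n _ _ => t0 n y).
    apply: le_trans; rewrite big_nat_recr//= leeDr//.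
    exact: sume_ge0.
  have M0 : 0 <= M by exact: fine_ge0.
  suff sD : cvgn (series (fun k => D k y)).
    rewrite (_ : (fun k => g k y) =
      (fun k => g 0%N y + series (fun k => D k y) k)); last first.
      apply/funext => k; rewrite seriesEnat /= (eq_bigr (fun k => g k.+1 y - g k y))//.
      by rewrite (telescope_sumr (fun k => g k y))// addrC subrK.
    by apply: is_cvgD => //; exact: is_cvg_cst.
  apply: normed_cvg.
  apply: (@series_le_cvg _ _ (geometric (Num.sqrt M) (2^-1))).
  - by move=> k; exact: normr_ge0.
  - by move=> k; rewrite mulr_ge0 ?sqrtr_ge0 ?exprn_ge0 ?invr_ge0.
  - move=> k; rewrite /geometric /= -[X in X * _]ger0_norm ?sqrtr_ge0//.
    rewrite exprVn ler_pdivlMr ?exprn_gt0//.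
    rewrite -[X in _ * X]ger0_norm ?exprn_ge0// -normrM.
    rewrite -ler_sqr ?nnegrE// -!normrX !ger0_norm ?sqr_ge0//.
    rewrite sqr_sqrtr// exprMn mulrC -exprM mulnC exprM.
    by rewrite (_ : (2 : R) ^+ 2 = 4); [exact: DM|ring].
  - by apply: is_cvg_geometric_series; rewrite ger0_norm ?invr_ge0// invf_lt1// ltr1n.
pose h y := if y \in A then limn (fun k => g k y) else 0.
have mh : measurable_fun setT h.
  apply: (@measurable_fun_cvg _ _ _ _ (fun k y => g k y * \1_A y)).
    move=> k; apply: measurable_funM; first exact: L2_measurable.
    exact: measurable_indic.
  move=> y _; rewrite /h; case: ifPn => yA.
    rewrite indicE yA; under eq_fun do rewrite mulr1.
    by apply: Acvg; rewrite inE in yA.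
  by rewrite indicE (negbTE yA); under eq_fun do rewrite mulr0; exact: cvg_cst.
have key e n0 : 0 < e -> (forall m n, (n0 <= m)%N -> (n0 <= n)%N ->
    l2form (x m - x n) (x m - x n) < e) -> forall n, (n0 <= n)%N ->
    (\int[mu]_y ((x n y - h y) ^+ 2)%:E <= e%:E)%E.
  move=> e0 hn0 n n0n.
  apply: (@l2_Fatou _ (fun k y => x n y - g k y) A) => //.
  - by apply: measurable_funB => //; exact: L2_measurable.
  - by move=> k; apply: measurable_funB; exact: L2_measurable.
  - move=> y Ay; apply: cvgB; first exact: cvg_cst.
    by rewrite /h mem_set//; exact: Acvg.
  exists n0 => // k /= n0k.
  rewrite (_ : (\int[mu]_y _)%E = (l2form (x n - g k) (x n - g k))%:E).
    by rewrite lee_fin ltW// hn0//; apply: leq_trans n0k _; exact: leq_addr.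
  by rewrite l2formE; apply: eq_integral => y _; rewrite l2_val_sub.
(* h is square integrable because x n1 and x n1 - h are. *)
have [n1 hn1] := cx _ ltr01.
have mxh : measurable_fun setT (fun y => x n1 y - h y).
  by apply: measurable_funB => //; exact: L2_measurable.
have lxh : (\int[mu]_y ((x n1 y - h y) ^+ 2)%:E < +oo)%E.
  by apply: le_lt_trans (key _ _ ltr01 hn1 _ (leqnn _)) _; rewrite ltry.
exists (x n1 - l2 mxh lxh) => e e0.
have e2 : 0 < e / 2 by rewrite divr_gt0.
have [n0 hn0] := cx _ e2; exists n0 => n n0n.
rewrite -lte_fin l2formE.
rewrite (eq_integral (fun y => ((x n y - h y) ^+ 2)%:E)); last first.
  move=> y _; rewrite !l2_val_sub -[l2 mxh lxh y]/(x n1 y - h y).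
  by congr ((_ ^+ _)%:E); ring.
apply: le_lt_trans (key _ _ e2 hn0 n n0n) _.
by rewrite lte_fin ltr_pdivrMr// ltr_pMr// ltr1n.
Qed.

Definition L2_semiHilbert : semiHilbert R :=
  SemiHilbert l2formC l2form_lin l2form_ge0 L2_complete.
End L2.

(** * Property (T) and invariant sets *)
Section measure_preserving.
Context d (T : measurableType d) (R : realType).
Variable nu : {measure set T -> \bar R}.
Context (Gamma : groupType) (a : Gamma -> T -> T).
Hypothesis a1 : forall x, a 1%g x = x.
Hypothesis aM : forall g h x, a (g * h)%g x = a g (a h x).
Hypothesis ma : forall g, measurable_fun setT (a g).
Hypothesis a_nu : forall g A, measurable A -> nu (a g @^-1` A) = nu A.

Lemma measurable_act g A : measurable A -> measurable (a g @^-1` A).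
Proof. by move=> mA; rewrite -[X in measurable X]setTI; exact: ma. Qed.

Lemma ge0_integral_act g (f : T -> \bar R) :
  measurable_fun setT f -> (forall x, (0 <= f x)%E) ->
  (\int[nu]_x f (a g x) = \int[nu]_x f x)%E.
Proof.
move=> mf f0.
have := ge0_integral_pushforward (ma g) nu measurableT mf (fun x _ => f0 x).
rewrite preimage_setT => <-.
by apply: eq_measure_integral => A mA _; exact: a_nu.
Qed.

Lemma L2_act_measurable g (f : L2 nu) :
  measurable_fun setT (fun x => f (a g^-1%g x)).
Proof. by apply: measurableT_comp => //; exact: L2_measurable. Qed.

Lemma L2_act_lty g (f : L2 nu) :
  (\int[nu]_x (f (a g^-1%g x) ^+ 2)%:E < +oo)%E.
Proof.
rewrite (ge0_integral_act g^-1 (f := fun x => (f x ^+ 2)%:E)).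
- exact: L2_lty.
- by apply/measurable_EFinP/measurable_funX; exact: L2_measurable.
- by move=> x; rewrite lee_fin sqr_ge0.
Qed.

Definition L2_act g (f : L2 nu) : L2 nu :=
  l2 (L2_act_measurable g f) (L2_act_lty g f).

Lemma L2_actE g f x : L2_act g f x = f (a g^-1%g x).
Proof. by []. Qed.

Lemma L2_act1 f : L2_act 1%g f = f.
Proof. by apply/LfuneqP => x; rewrite L2_actE invg1 a1. Qed.

Lemma L2_actM g h f : L2_act (g * h)%g f = L2_act g (L2_act h f).
Proof. by apply/LfuneqP => x; rewrite !L2_actE invgM aM. Qed.

Lemma L2_act_iso g f h : l2form (L2_act g f) (L2_act g h) = l2form f h.
Proof.
congr fine; rewrite -[LHS]/(\int[nu]_x ((EFin \o (f \* h)%R) \o a g^-1%g) x)%E.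
have mfh : measurable_fun setT (EFin \o (f \* h)).
  by apply/measurable_EFinP; apply: measurable_funM; exact: L2_measurable.
have ifh : nu.-integrable (a g^-1%g @^-1` setT) ((EFin \o (f \* h)) \o a g^-1%g).
  by rewrite preimage_setT; exact: L2_integrableM (L2_act g f) (L2_act g h).
have := integral_pushforward (ma g^-1%g) mfh ifh measurableT.
rewrite preimage_setT => <-.
by apply: eq_measure_integral => A mA _; exact: a_nu.
Qed.

Lemma measurable_act_neq (v : L2 nu) g : measurable [set x | v (a g x) != v x].
Proof.
have mv := L2_measurable v.
have mvg : measurable_fun setT (fun x => v (a g x)) by exact: measurableT_comp.
rewrite (_ : [set _ | _] =
    setT `&` (fun x => v (a g x) - v x) @^-1` (~` [set 0])).
  by apply: measurable_funB => //; exact: measurableC.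
rewrite setTI; apply/seteqP; split => x /=; rewrite -subr_eq0; first by move/eqP.
by move=> ?; apply/eqP.
Qed.

(** Property (T) for the representation of Gamma on L2, restricted to the
    orthogonal complement of an invariant function u. Since elements of L2 are
    genuine functions, the conclusion is invariance up to null sets. *)
Lemma kazhdan_L2 (Q : {fset Gamma}) (eps : R) (u f : L2 nu) :
  0 < eps -> kazhdan_pair Q eps -> (forall g x, u (a g x) = u x) ->
  l2form f u = 0 -> 0 < l2form f f ->
  (forall g, g \in Q ->
     (\int[nu]_x ((f (a g^-1%g x) - f x) ^+ 2)%:E < (eps ^+ 2 * l2form f f)%:E)%E) ->
  exists v : L2 nu, [/\ l2form v u = 0, 0 < l2form v v &
    forall g, nu [set x | v (a g x) != v x] = 0].
Proof.
move=> e0 kp uinv fu f0 fQ.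
have au g (x : L2 nu) : l2form x (L2_act g u) = l2form x u.
  by congr (l2form x _); apply/LfuneqP => y; rewrite L2_actE uinv.
have [|v [vu v0 vinv]] := @kazhdan_semiHilbert R (L2_semiHilbert nu) u Gamma
  L2_act L2_act1 L2_actM L2_act_iso au Q eps f e0 kp fu f0.
  move=> g gQ; rewrite -lte_fin; apply: le_lt_trans (fQ g gQ).
  by rewrite [X in (X <= _)%E]l2formE.
exists v; split => // g.
have mv := L2_measurable v.
have mvg : measurable_fun setT (fun x => v (a g x)).
  exact: measurableT_comp.
have h : (\int[nu]_x ((L2_act g^-1%g v - v) x ^+ 2)%:E = 0)%E.
  by rewrite -l2formE; congr EFin; exact: vinv.
have m2 : measurable_fun setT (EFin \o (fun x => (v (a g x) - v x) ^+ 2)).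
  by apply/measurable_EFinP/measurable_funX/measurable_funB.
have [+ _] := ae_eq_integral_abs nu measurableT m2; move=> [|N [mN N0 hN]].
  rewrite -[RHS]h; apply: eq_integral => x _.
  by rewrite l2_val_sub L2_actE invgK /= ger0_norm ?sqr_ge0.
apply: (subset_measure0 _ mN _ N0).
  exact: measurable_act_neq.
move=> x /= vx; apply: hN => /= /(_ I) [/eqP].
by rewrite sqrf_eq0 subr_eq0 (negbTE vx).
Qed.

Section enumerated.
Variable enum_Gamma : nat -> Gamma.
Hypothesis enum_surj : forall g, exists n, enum_Gamma n = g.

Definition act_invariant (A : set T) := forall g x, A (a g x) <-> A x.

(** As Gamma is countable, the points whose whole orbit is mapped to D by v form a
    measurable set, and almost every point of v^-1(D) is of this kind. *)
Lemma invariant_level_set (v : L2 nu) (D : set R) :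
  measurable D -> (forall g, nu [set x | v (a g x) != v x] = 0%E) ->
  exists A, [/\ measurable A, act_invariant A, A `<=` v @^-1` D &
    nu (v @^-1` D `\` A) = 0%E].
Proof.
move=> mD vinv.
have mv g : measurable (a g @^-1` (v @^-1` D)).
  by apply: measurable_act; rewrite -[X in measurable X]setTI; exact: L2_measurable.
pose A := \bigcap_n (a (enum_Gamma n) @^-1` (v @^-1` D)).
have AE x : A x <-> forall g, D (v (a g x)).
  split=> [Ax g|Ax n _]; last exact: Ax.
  by have [n <-] := enum_surj g; exact: Ax.
have mA : measurable A by apply: bigcapT_measurable => n; exact: mv.
have mvD : measurable (v @^-1` D).
  by rewrite -[X in measurable X]setTI; exact: L2_measurable.
exists A; split => //.
- move=> g x; rewrite !AE; split=> h k; last by rewrite -aM.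
  by have := h (k * g^-1)%g; rewrite -aM mulgVK.
- by move=> x /AE /(_ 1%g); rewrite a1.
have /negligibleP : nu.-negligible (v @^-1` D `\` A); last first.
  by apply; exact: measurableD.
apply: (@negligibleS _ _ _ _ (\bigcup_n [set x | v (a (enum_Gamma n) x) != v x])).
  move=> x [/= Dx] /existsNP[n] /not_implyP[_ /= nD]; exists n => //=.
  by apply: contra_notN nD => /eqP ->.
apply: negligible_bigcup => n.
by apply/negligibleP; [exact: measurable_act_neq|exact: vinv].
Qed.

Lemma integral_sqr_indic (E : set T) : measurable E ->
  (\int[nu]_x ((\1_E x : R) ^+ 2)%:E)%E = nu E.
Proof.
move=> mE; rewrite -[in RHS](setIT E) -integral_indic//.
by apply: eq_integral => x _; rewrite indicE; case: (x \in E); rewrite ?expr1n ?expr0n.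
Qed.

Lemma indic_lty (E : set T) : measurable E -> (nu E < +oo)%E ->
  (\int[nu]_x ((\1_E x : R) ^+ 2)%:E < +oo)%E.
Proof. by move=> mE; rewrite integral_sqr_indic. Qed.

Definition indicL2 E (mE : measurable E) (fE : (nu E < +oo)%E) : L2 nu :=
  l2 (measurable_indic (R:=R) mE) (indic_lty mE fE).

Lemma integral_symdiff (E F : set T) : measurable E -> measurable F ->
  (\int[nu]_x (((\1_E x : R) - \1_F x) ^+ 2)%:E)%E = nu (E `+` F).
Proof.
move=> mE mF; rewrite -integral_sqr_indic; last first.
  exact: measurableU (measurableD _ _) (measurableD _ _).
apply: eq_integral => x _; rewrite !indicE.
have -> : (x \in E `+` F) = (x \in E) (+) (x \in F).
  apply/idP/idP; rewrite !inE.
    by case=> -[h1 h2]; rewrite (mem_set h1) (memNset h2).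
  case: (boolP (x \in E)) => h1; case: (boolP (x \in F)) => h2 //= _;
    rewrite ?inE ?notin_setE in h1 h2; by [left|right].
by case: (x \in E); case: (x \in F) => /=; congr EFin; ring.
Qed.

(** The indicator of E is an almost invariant vector of L2, so there is an
    invariant v that is not null. Some set {v^2 > t} with t > 0 is then not
    null, and it has finite measure since v^2 is integrable. *)
Lemma kazhdan_invariant_set (Q : {fset Gamma}) (eps : R) (E : set T) :
  0 < eps -> kazhdan_pair Q eps -> measurable E ->
  (0 < nu E)%E -> (nu E < +oo)%E ->
  (forall g, g \in Q ->
     (nu ((a g^-1%g @^-1` E) `+` E) < (eps ^+ 2)%:E * nu E)%E) ->
  exists A, [/\ measurable A, act_invariant A, (0 < nu A)%E & (nu A < +oo)%E].
Proof.
move=> e0 kp mE E0 Efin EQ.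
pose f := indicL2 mE Efin.
have ff : (l2form f f)%:E = nu E by rewrite l2formE integral_sqr_indic.
have [||||v [_ v0 vinv]] := @kazhdan_L2 Q eps 0 f e0 kp.
- by [].
- by rewrite (form0r (@l2formC _ _ _ nu) (@l2form_lin _ _ _ nu)).
- by rewrite -lte_fin ff.
- move=> g gQ; rewrite EFinM ff; apply: le_lt_trans (EQ g gQ).
  rewrite -integral_symdiff//; exact: measurable_act.
have mv := L2_measurable v.
have mD t : measurable [set r : R | t < r ^+ 2].
  rewrite -[X in measurable X]setTI.
  have : measurable_fun setT (fun r : R => r ^+ 2) by exact: measurable_funX.
  move=> /(_ measurableT _ (measurable_itv `]t, +oo[)).
  by congr measurable; apply/seteqP; split => r /=; rewrite in_itv/= andbT.
have mvD t : measurable [set x | t < v x ^+ 2].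
  rewrite -[X in measurable X]setTI; exact: mv (mD t).
have [t t0 vt] : exists2 t, 0 < t & nu [set x | t < v x ^+ 2] != 0%E.
  apply: contrapT => /forall2NP h.
  have hz n : nu [set x | n.+1%:R^-1 < v x ^+ 2] = 0%E.
    by have [|/negP/negPn/eqP] := h (n.+1%:R^-1); rewrite ?invr_gt0 ?ltr0n.
  suff : l2form v v = 0 by move=> vv0; rewrite vv0 ltxx in v0.
  apply: EFin_inj; rewrite l2formE.
  rewrite -[RHS](integral0 nu setT); apply: ge0_ae_eq_integral => //.
  - by apply/measurable_EFinP/measurable_funX.
  - by move=> x _; rewrite lee_fin sqr_ge0.
  have : nu.-negligible (\bigcup_n [set x | n.+1%:R^-1 < v x ^+ 2]).
    by apply: negligible_bigcup => n; apply/negligibleP; [exact: mvD|exact: hz].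
  apply: negligibleS => x /= /not_implyP[_ /eqP]; rewrite eqe sqrf_eq0 => vx.
  have vx2 : 0 < v x ^+ 2 by rewrite lt_neqAle eq_sym sqrf_eq0 vx sqr_ge0.
  exists (Num.truncn (v x ^+ 2)^-1) => //=.
  by rewrite invf_plt ?posrE// truncnS_gt.
have [A [mA Ainv AD DA]] := invariant_level_set (mD t) vinv.
have nuA : nu A = nu [set x | t < v x ^+ 2].
  have -> : [set x | t < v x ^+ 2] = A `|` (v @^-1` [set r | t < r ^+ 2] `\` A).
    by rewrite setDUK.
  rewrite measureU//.
  - by transitivity (nu A + 0)%E; [rewrite adde0|congr (_ + _)%E; exact/esym/DA].
  - by apply: measurableD => //; exact: mvD.
  - by rewrite setDIK.
exists A; split => //; rewrite nuA.
  by rewrite lt_neqAle eq_sym vt measure_ge0.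
rewrite -(@lte_pmul2l _ t%:E) ?lte_fin//.
have : (t%:E * nu [set x | (t < v x ^+ 2)%R] <= \int[nu]_x (v x ^+ 2)%:E)%E.
  rewrite -[X in nu X](setIT) -integral_indic// -ge0_integralZl_EFin//=.
  - apply: ge0_le_integral => //.
    + by move=> x _; rewrite mule_ge0// lee_fin ltW.
    + apply/measurable_EFinP; apply: measurable_funM => //; exact: measurable_indic.
    + by apply/measurable_EFinP/measurable_funX.
    move=> x _; rewrite -EFinM lee_fin indicE; case: (boolP (x \in _)) => [|_].
      by rewrite inE /= mulr1 => /ltW.
    by rewrite mulr0 sqr_ge0.
  - by apply/measurable_EFinP; exact: measurable_indic.
  - exact: ltW.
move=> h; apply: le_lt_trans h _.
rewrite gt0_muley ?lte_fin//; exact: L2_lty.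
Qed.

Lemma L2_null (v : L2 nu) : l2form v v != 0 -> ~ (v = cst 0 %[ae nu]).
Proof.
move=> /eqP v0 vae; apply: v0; apply: EFin_inj; rewrite l2formE.
rewrite -[RHS](integral0 nu setT); apply: ge0_ae_eq_integral => //.
- by apply/measurable_EFinP/measurable_funX; exact: L2_measurable.
- by move=> x _; rewrite lee_fin sqr_ge0.
by apply: filterS vae => x /= /(_ I) -> _; rewrite expr0n.
Qed.

(** The sign s allows v to be nonnegative or nonpositive. *)
Lemma L2_signed_null (v : L2 nu) (s : R) : nu.-integrable setT (EFin \o v) ->
  (\int[nu]_x (v x)%:E = 0)%E -> `|s| = 1 ->
  (\forall x \ae nu, 0 <= s * v x) -> v = cst 0 %[ae nu].
Proof.
move=> iv v0 s1 sv.
have mv : measurable_fun setT (EFin \o v) by apply/measurable_EFinP/L2_measurable.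
have [+ _] := ae_eq_integral_abs nu measurableT mv; move=> h.
have : (\int[nu]_x `|(EFin \o v) x| = 0)%E.
  rewrite (ae_eq_integral (fun x => s%:E * (v x)%:E)%E)//.
  - by rewrite integralZl// v0 mule0.
  - exact: measurableT_comp.
  - by apply: emeasurable_funM => //; exact: measurable_cst.
  apply: filterS sv => x sv _ /=.
  by rewrite -EFinM -[in RHS](ger0_norm sv) normrM s1 mul1r.
move=> /h; apply: filterS => x /= + _ => /(_ I) [].
by [].
Qed.

Definition act_ergodic := forall A, measurable A -> act_invariant A ->
  nu A = 0%E \/ nu (~` A) = 0%E.

(** Ergodicity made quantitative by property (T): if the inequality failed, the
    centred indicator of E would be almost invariant, and there would be an
    invariant function of mean zero that is not null. By ergodicity its sign is
    almost everywhere constant, so it would be null after all. *)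
Lemma spectral_gap (Q : {fset Gamma}) (eps : R) (E : set T) :
  0 < eps -> kazhdan_pair Q eps -> (nu setT < +oo)%E -> act_ergodic ->
  measurable E ->
  eps ^+ 2 * (fine (nu E) * fine (nu (~` E))) <=
  fine (nu setT) * \sum_(g <- Q) fine (nu ((a g^-1%g @^-1` E) `+` E)).
Proof.
move=> e0 kp Tfin erg mE; rewrite leNgt; apply/negP => lt.
have fin A : measurable A -> nu A \is a fin_num.
  move=> mA; rewrite ge0_fin_numE//.
  by apply: le_lt_trans Tfin; apply: le_measure; rewrite ?inE.
have finlt A : measurable A -> (nu A < +oo)%E by move=> /fin; rewrite ge0_fin_numE.
set K := fine (nu setT) in lt; set m := fine (nu E) in lt.
have mEC : measurable (~` E) by exact: measurableC.
have mCE : fine (nu (~` E)) = K - m.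
  rewrite -setTD measureD// setTI fineB//; exact: fin.
rewrite mCE in lt.
have S0 : 0 <= \sum_(g <- Q) fine (nu ((a g^-1%g @^-1` E) `+` E)).
  by apply: sumr_ge0 => g _; exact: fine_ge0.
have K0 : 0 < K.
  rewrite lt_neqAle fine_ge0// andbT; apply/eqP => K0.
  have m0 : m = 0.
    apply/eqP; rewrite eq_le fine_ge0// andbT K0 fine_le ?fin//.
    by apply: le_measure; rewrite ?inE.
  by move: lt; rewrite m0 -K0 !mul0r mulr0 ltxx.
pose one : L2 nu := indicL2 measurableT Tfin.
pose iE : L2 nu := indicL2 mE (finlt _ mE).
have oneE x : one x = 1 by rewrite -[LHS]/(\1_setT x) indicE in_setT.
have iEE x : iE x = \1_E x by [].
(* f is the projection of the indicator of E to the functions of mean zero. *)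
pose f : L2 nu := iE - (m / K) *: one.
have fE x : f x = \1_E x - m / K.
  by rewrite l2_val_sub -[((m / K) *: one) x]/(m / K * one x) oneE mulr1 iEE.
have b11 : l2form one one = K.
  by apply: EFin_inj; rewrite l2formE integral_sqr_indic// fineK// fin.
have bEE : l2form iE iE = m.
  by apply: EFin_inj; rewrite l2formE integral_sqr_indic// fineK// fin.
have bE1 : l2form iE one = m.
  rewrite -bEE; apply: eq_Rintegral => x _; rewrite oneE iEE indicE.
  by case: (x \in E); rewrite ?mulr1 ?mulr0.
have lB x y z : l2form (x - y) z = l2form x z - l2form y z.
  by apply: formBl; exact: l2form_lin.
have lZ t y z : l2form (t *: y) z = t * l2form y z.
  by apply: formZl; exact: l2form_lin.
have f1 : l2form f one = 0 by rewrite lB lZ bE1 b11 mulfVK ?subrr// gt_eqF.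
have ff : l2form f f = m * (K - m) / K.
  rewrite {2}/f l2formC lB lZ !(l2formC _ f) f1 mulr0 subr0.
  rewrite lB bEE lZ (l2formC one) bE1.
  by field; rewrite gt_eqF.
have ff0 : 0 < l2form f f.
  rewrite ff divr_gt0// -(pmulr_rgt0 _ (exprn_gt0 2 e0)).
  by apply: le_lt_trans lt; rewrite mulr_ge0// ltW.
have [|g gQ|v [v1 v0 vinv]] := @kazhdan_L2 Q eps one f e0 kp _ f1 ff0.
- by move=> g x; rewrite !oneE.
- rewrite (eq_integral (fun x => (((\1_(a g^-1%g @^-1` E) x : R) - \1_E x) ^+ 2)%:E)); last first.
    move=> x _; rewrite !fE; congr (_ ^+ _)%:E.
    have -> : (\1_(a g^-1%g @^-1` E) x : R) = \1_E (a g^-1%g x).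
      by rewrite !indicE; congr (_%:R); apply/idP/idP; rewrite !inE.
    by ring.
  have mg : measurable (a g^-1%g @^-1` E) by exact: measurable_act.
  rewrite integral_symdiff// -[X in (X < _)%E]fineK; last first.
    by apply: fin; apply: measurableU; exact: measurableD.
  rewrite lte_fin ff mulrA ltr_pdivlMr// mulrC.
  apply: le_lt_trans lt; rewrite ler_pM2l//.
  rewrite (big_fsetD1 g)//= lerDl.
  by apply: sumr_ge0 => h _; exact: fine_ge0.
have mv := L2_measurable v.
(* If A is null then v <= 0 almost everywhere, and if its complement is null then
   v > 0 almost everywhere. *)
have [A [mA Ainv AD DA]] := invariant_level_set (measurable_itv `]0, +oo[) vinv.
have iv : nu.-integrable setT (EFin \o v).
  rewrite (_ : EFin \o v = EFin \o (v \* one)); first exact: L2_integrableM.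
  by apply/funext => x; rewrite -[RHS]/((v x * one x)%:E) oneE mulr1.
have v10 : (\int[nu]_x (v x)%:E = 0)%E.
  rewrite -[LHS]fineK; last exact: integrable_fin_num.
  congr EFin; rewrite -v1; apply: eq_Rintegral => x _.
  by rewrite oneE mulr1.
have vn0 : l2form v v != 0 by rewrite gt_eqF.
have mpos : measurable (v @^-1` `]0, +oo[).
  by rewrite -[X in measurable X]setTI; exact: mv.
have [A0|A0] := erg A mA Ainv.
- apply: (L2_null vn0); apply: (@L2_signed_null v (-1)) => //.
    by rewrite normrN normr1.
  have : nu.-negligible (A `|` (v @^-1` `]0, +oo[ `\` A)).
    apply: negligibleU; apply/negligibleP => //; exact: measurableD.
  apply: negligibleS => x /=; rewrite mulN1r oppr_ge0 => /negP; rewrite -ltNge => vx.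
  by have [Ax|nAx] := pselect (A x); [left|right; split => //=; rewrite in_itv/= andbT].
- apply: (L2_null vn0); apply: (@L2_signed_null v 1) => //; first by rewrite normr1.
  have : nu.-negligible (~` A) by apply/negligibleP => //; exact: measurableC.
  apply: negligibleS => x /=; rewrite mul1r => /negP; rewrite -ltNge => vx Ax.
  by have := AD _ Ax; rewrite /= in_itv/= andbT => /lt_trans /(_ vx); rewrite ltxx.
Qed.

End enumerated.
End measure_preserving.

(** * Approximation in measure by an algebra of sets *)
Section approximation.
Context d (T : measurableType d) (R : realType) (P : probability T R).
Variable Alg : set (set T).
Hypothesis Algm : Alg `<=` measurable.
Hypothesis AlgC : forall A, Alg A -> Alg (~` A).
Hypothesis AlgI : forall A B, Alg A -> Alg B -> Alg (A `&` B).
Hypothesis AlgT : Alg setT.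

Definition approximable (D : set T) := measurable D /\
  forall e : R, 0 < e -> exists2 A, Alg A & (P (D `+` A) < e%:E)%E.

Lemma measurable_setY (A B : set T) :
  measurable A -> measurable B -> measurable (A `+` B).
Proof. by move=> mA mB; apply: measurableU; exact: measurableD. Qed.

Lemma setYCC (A B : set T) : ~` A `+` ~` B = A `+` B.
Proof.
by rewrite /setY /= !setDE !setCK [X in _ `|` X]setIC setUC [X in X `|` _]setIC
  [_ `&` ~` B]setIC [~` A `&` B]setIC.
Qed.

Lemma approximable_sigma_algebra : sigma_algebra setT approximable.
Proof.
split.
- split=> // e e0; exists set0; first by rewrite -setCT; exact: AlgC.
  by rewrite /setY !set0D set0U measure0 lte_fin.
- move=> D [mD hD]; rewrite setTD; split; first exact: measurableC.
  move=> e /hD[A AA DA]; exists (~` A); first exact: AlgC.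
  by rewrite setYCC.
move=> F hF; have mF n : measurable (F n) by have [] := hF n.
have mbF : measurable (\bigcup_k F k) by exact: bigcupT_measurable.
split=> // e e0.
pose G n := \bigcup_(k < n) F k.
have mG n : measurable (G n) by exact: bigcup_measurable.
have GF : \bigcup_n G n = \bigcup_n F n.
  apply/seteqP; split=> x.
    by move=> [n _ [k _ Fk]]; exists k.
  by move=> [n _ Fn]; exists n.+1 => //; exists n => /=.
have ndG : nondecreasing_seq G.
  move=> m n mn; rewrite subsetEset => x [k km Fk]; exists k => //=.
  exact: leq_trans mn.
have cG : P (G n) @[n --> \oo] --> P (\bigcup_k F k).
  by rewrite -GF; apply: nondecreasing_cvg_mu => //; rewrite GF.
have e2 : 0 < e / 2 by rewrite divr_gt0.
(* A countable union is within e / 2 of the union of its first n terms, and each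
   of these is approximated within e / 2 / n.+1. *)
have [n hn] : exists n, (P (\bigcup_k F k `\` G n) < (e / 2)%:E)%E.
  have Pfin A : measurable A -> P A \is a fin_num by exact: fin_num_measure.
  have : \forall n \near \oo, `|fine (P (\bigcup_k F k)) - fine (P (G n))| < e / 2.
    have /fine_cvgP[_] : P (G n) @[n --> \oo] --> (fine (P (\bigcup_k F k)))%:E.
      by rewrite fineK// Pfin.
    by move/cvgrPdist_lt; apply.
  move=> [n _ /(_ n (leqnn n)) hn]; exists n.
  rewrite measureD//; last by rewrite -ge0_fin_numE// Pfin.
  rewrite setIidr; last by rewrite -GF; exact: bigcup_sup.
  apply: (@le_lt_trans _ _ (fine (P (\bigcup_k F k)) - fine (P (G n)))%:E).
    by rewrite EFinB !fineK ?Pfin.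
  by rewrite lte_fin; exact: le_lt_trans (ler_norm _) hn.
have en : 0 < e / 2 / n.+1%:R by rewrite divr_gt0// ltr0n.
have [A hA] := choice (fun k =>
  (let: ex_intro2 A h1 h2 := (hF k).2 _ en in ex_intro
     (fun A => Alg A /\ (P (F k `+` A) < (e / 2 / n.+1%:R)%:E)%E) A (conj h1 h2))).
have AlgU : Alg (\big[setU/set0]_(k < n) A k).
  elim: n {hn en hA} (fun k => (hA k).1) => [|n IH] hA.
    by rewrite big_ord0 -setCT; exact: AlgC.
  rewrite big_ord_recr /= -[X in Alg X]setCK setCU.
  by apply: AlgC; apply: AlgI; apply: AlgC; [exact: IH|exact: hA].
exists (\big[setU/set0]_(k < n) A k) => //.
have mA k : measurable (A k) by apply: Algm; case: (hA k).
apply: (@le_lt_trans _ _ (P (\bigcup_k F k `\` G n) +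
   \sum_(k < n) P (F k `+` A k))%E).
  apply: le_trans (_ : P ((\bigcup_k F k `\` G n) `|`
     \big[setU/set0]_(k < n) (F k `+` A k)) <= _)%E.
    apply: le_measure; rewrite ?inE.
    - by apply: measurable_setY => //; exact: bigsetU_measurable.
    - apply: measurableU; first exact: measurableD.
      by apply: bigsetU_measurable => k _; exact: measurable_setY.
    rewrite -(bigcup_mkord n A) -(bigcup_mkord n (fun k => F k `+` A k)).
    move=> x [[[k _ Fk] nA]|[[k kn Ak] nF]].
      have [[j jn Fj]|nG] := pselect (G n x); last by left; split=> //; exists k.
      right; exists j => //; left; split=> // Aj.
      by apply: nA; exists j.
    by right; exists k => //; right; split=> // Fk; apply: nF; exists k.
  apply: le_trans (measureU2 _ _ _) _.
  - exact: measurableD.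
  - by apply: bigsetU_measurable => k _; exact: measurable_setY.
  rewrite leeD2l//.
  apply: (@Boole_inequality _ _ _ P (fun k => F k `+` A k)) => k _.
  exact: measurable_setY.
rewrite [e]splitr EFinD; apply: lte_leD => //.
  apply/sum_fin_numP => k _ _; apply: fin_num_measure.
  exact: measurable_setY.
apply: (@le_trans _ _ (\sum_(k < n) (e / 2 / n.+1%:R)%:E)%E).
  by apply: lee_sum => k _; apply: ltW; case: (hA k).
rewrite sumEFin lee_fin sumr_const card_ord -[leLHS]mulr_natr -[leLHS]mulrA.
rewrite ger_pMr// mulrC ler_pdivrMr ?ltr0n// mul1r ler_nat.
exact: leqnSn.
Qed.

(** The approximable sets form a sigma-algebra that contains the generators. *)
Lemma algebra_approximation :
  measurable `<=` <<s Alg >> -> forall D, measurable D -> approximable D.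
Proof.
move=> mAlg D /mAlg; apply: smallest_sub; first exact: approximable_sigma_algebra.
move=> A AA; split; first exact: Algm.
by move=> e e0; exists A => //; rewrite /setY setDv setU0 measure0 lte_fin.
Qed.

End approximation.

(** * Ergodicity of independent labels *)
Section product_space.
Context (I : Type) dT (T : measurableType dT).

Lemma measurable_prodspace d (X : measurableType d) (f : X -> prodspace I T) :
  (forall i, measurable_fun setT (fun x => f x i)) -> measurable_fun setT f.
Proof.
move=> mf; apply: (@measurability _ _ X (prodspace I T) setT f (@cylinders I dT T)) => //.
move=> _ [_ [i [B [mB ->]]] <-].
by exact: mf.
Qed.

Lemma measurable_evaluation i (B : set T) : measurable B ->
  measurable ([set w | B (w i)] : set (prodspace I T)).
Proof. by move=> mB; apply: sub_sigma_algebra; exists i, B. Qed.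

End product_space.

Section iid_labels.
Context (R : realType) (I : Type) d (Omega : measurableType d).
Variables (P : probability Omega R) (U : I -> {RV P >-> R}).
Hypothesis iidU : iid_uniform U.

Definition labels (w : Omega) : prodspace I R := fun i => U i w.

Lemma measurable_labels : measurable_fun setT labels.
Proof. by apply: measurable_prodspace => i; exact: measurable_funPT. Qed.

HB.instance Definition _ := isMeasurableFun.Build _ _ _ _ labels measurable_labels.

Definition label_law : probability (prodspace I R) R := distribution P labels.

Definition fbox n (i : 'I_n -> I) (B : 'I_n -> set R) : set (prodspace I R) :=
  [set w | forall k, B k (w (i k))].

Lemma label_law_fbox n (i : 'I_n -> I) B : injective i ->
  (forall k, measurable (B k)) ->
  label_law (fbox i B) = (\prod_(k < n) uniform_prob (@ltr01 R) (B k))%E.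
Proof.
move=> inji mB; have [unif indep] := iidU.
transitivity (P [set w | forall k, B k (U (i k) w)]); first by [].
by rewrite indep//; apply: eq_bigr => k _; exact: unif.
Qed.

Lemma measurable_fbox n (i : 'I_n -> I) B :
  (forall k, measurable (B k)) -> measurable (fbox i B).
Proof.
move=> mB; rewrite (_ : fbox i B =
    \bigcap_(k in [set: 'I_n]) [set w : prodspace I R | B k (w (i k))]).
  by apply: fin_bigcap_measurable => // k _; exact: measurable_evaluation.
by apply/seteqP; split => w h k; [move=> _|]; exact: h.
Qed.

(** A pi-system; the sigma-algebra that it generates consists of the events that
    depend only on the labels with an index in i. *)
Definition boxes n (i : 'I_n -> I) : set (set (prodspace I R)) :=
  [set A | exists2 B, (forall k, measurable (B k)) & A = fbox i B].

Lemma boxesI n (i : 'I_n -> I) : setI_closed (boxes i).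
Proof.
move=> _ _ [B mB ->] [B' mB' ->]; exists (fun k => B k `&` B' k).
  by move=> k; exact: measurableI.
by apply/seteqP; split => w; [move=> [h h'] k; split|move=> h; split=> k; have [] := h k].
Qed.

Lemma boxesT n (i : 'I_n -> I) : boxes i setT.
Proof. by exists (fun=> setT) => //; apply/seteqP; split. Qed.

Lemma boxes_measurable n (i : 'I_n -> I) : boxes i `<=` measurable.
Proof. by move=> _ [B mB ->]; exact: measurable_fbox. Qed.

(** Uniqueness of measures, applied to A |-> P (A `&` C) and A |-> P A * P C. *)
Lemma label_law_indep_ext (G : set (set (prodspace I R))) C :
  G `<=` measurable -> setI_closed G -> G setT -> measurable C ->
  (forall A, G A -> label_law (A `&` C) = label_law A * label_law C)%E ->
  forall A, <<s G >> A -> label_law (A `&` C) = (label_law A * label_law C)%E.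
Proof.
move=> Gm GI GT mC h.
have r0 : 0 <= fine (label_law C) by exact: fine_ge0.
pose m1 := mrestr label_law mC; pose m2 := mscale (NngNum r0) label_law.
have m2E A : m2 A = (label_law A * label_law C)%E.
  by rewrite /m2 /mscale /= fineK ?fin_num_measure// muleC.
move=> A GA; rewrite -m2E -[LHS]/(m1 A).
apply: (@g_sigma_algebra_measure_unique _ _ _ G Gm (fun=> setT)) => //.
- by rewrite bigcup_const.
- by move=> B GB; rewrite [RHS]m2E; exact: h.
move=> _; rewrite -[X in (X < _)%E]/(label_law (setT `&` C)).
by rewrite -ge0_fin_numE// fin_num_measure// setTI.
Qed.

(** The product rule for boxes is extended to one of the two events at a time. *)
Lemma label_law_indep n m (i : 'I_n -> I) (j : 'I_m -> I) A C :
  injective i -> injective j -> (forall k l, i k <> j l) ->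
  <<s boxes i >> A -> <<s boxes j >> C ->
  label_law (A `&` C) = (label_law A * label_law C)%E.
Proof.
move=> ii ij dij GA GC.
have sm k (f : 'I_k -> I) : <<s boxes f >> `<=` measurable.
  by apply: smallest_sub; [exact: sigma_algebra_measurable|exact: boxes_measurable].
apply: (@label_law_indep_ext (boxes i)) GA => //.
- exact: boxes_measurable.
- exact: boxesI.
- exact: boxesT.
- exact: sm GC.
move=> B GB; rewrite setIC muleC.
apply: (@label_law_indep_ext (boxes j)) GC => //.
- exact: boxes_measurable.
- exact: boxesI.
- exact: boxesT.
- exact: boxes_measurable GB.
move=> _ [D mD ->]; case: GB => B' mB' ->.
pose ij0 (k : 'I_(m + n)) := match fintype.split k with inl a => j a | inr b => i b end.
pose DB (k : 'I_(m + n)) := match fintype.split k with inl a => D a | inr b => B' b end.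
have -> : fbox j D `&` fbox i B' = fbox ij0 DB.
  apply/seteqP; split => w.
    move=> [h1 h2] k; rewrite /ij0 /DB; case: (fintype.split k) => a; [exact: h1|exact: h2].
  move=> h; split => k.
    by have := h (lshift n k); rewrite /ij0 /DB -[lshift n k]/(unsplit (inl k)) fintype.unsplitK.
  by have := h (rshift m k); rewrite /ij0 /DB -[rshift m k]/(unsplit (inr k)) fintype.unsplitK.
rewrite !label_law_fbox//.
- rewrite big_split_ord/=; congr (_ * _)%E; apply: eq_bigr => k _; rewrite /DB.
    by rewrite -[lshift n k]/(unsplit (inl k)) fintype.unsplitK.
  by rewrite -[rshift m k]/(unsplit (inr k)) fintype.unsplitK.
- move=> k l; rewrite /ij0 -{2}(fintype.splitK k) -{2}(fintype.splitK l).
  case: (fintype.split k) => a; case: (fintype.split l) => c //.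
  + by move=> /ij ->.
  + by move=> /esym /dij.
  + by move=> /dij.
  + by move=> /ii ->.
- by move=> k; rewrite /DB; case: (fintype.split k).
Qed.

Lemma boxes_sub n m (i : 'I_n -> I) (l : 'I_m -> I) :
  (forall k, exists k', i k = l k') -> boxes i `<=` boxes l.
Proof.
move=> il _ [B mB ->].
exists (fun k' => \bigcap_(k in [set k | i k = l k']) B k).
  move=> k'; apply: fin_bigcap_measurable; first exact: finite_finset.
  by move=> k _; exact: mB.
apply/seteqP; split => w h.
  by move=> k' k /= ikl; rewrite -ikl; exact: h.
by move=> k; have [k' e] := il k; rewrite e; exact: (h k').
Qed.

(** Repetitions must be removed, for the product rule is about distinct indices. *)
Lemma common_enumeration n m (i : 'I_n -> I) (j : 'I_m -> I) :
  exists k (l : 'I_k -> I), [/\ injective l,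
    forall a, exists b, i a = l b & forall a, exists b, j a = l b].
Proof.
pose s : seq {classic I} :=
  undup ([seq (i a : {classic I}) | a <- enum 'I_n] ++
         [seq (j a : {classic I}) | a <- enum 'I_m]).
have us : uniq s by exact: undup_uniq.
have inS (x : {classic I}) : x \in s -> exists b : 'I_(size s), x = tnth (in_tuple s) b.
  by move=> /(tnthP (in_tuple s)).
exists (size s), (tnth (in_tuple s)); split.
- by have /tuple_uniqP : uniq (in_tuple s) := us.
- by move=> a; apply: inS; rewrite mem_undup mem_cat map_f ?mem_enum.
- by move=> a; apply: inS; rewrite mem_undup mem_cat orbC map_f ?mem_enum.
Qed.

Definition finite_boxes : set (set (prodspace I R)) :=
  [set A | exists n (i : 'I_n -> I), injective i /\ boxes i A].

Lemma finite_boxesI : setI_closed finite_boxes.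
Proof.
move=> A B [n [i [ii Ai]]] [m [j [ij Bj]]].
have [k [l [il h1 h2]]] := common_enumeration i j.
exists k, l; split => //; apply: boxesI.
  exact: boxes_sub h1 _ Ai.
exact: boxes_sub h2 _ Bj.
Qed.

Lemma finite_boxes_measurable : finite_boxes `<=` measurable.
Proof. by move=> A [n [i [_ /boxes_measurable]]]. Qed.

Lemma boxes_cylinder i (B : set R) : measurable B ->
  boxes (fun _ : 'I_1 => i) [set w | B (w i)].
Proof.
by move=> mB; exists (fun=> B) => //; apply/seteqP; split => w h //; exact: (h ord0).
Qed.

Lemma injective_ord1 (x : I) : injective (fun _ : 'I_1 => x).
Proof. by move=> a b _; rewrite !ord1. Qed.

Lemma measurable_finite_boxes :
  (measurable : set (set (prodspace I R))) `<=` <<s finite_boxes >>.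
Proof.
apply: smallest_sub; first exact: smallest_sigma_algebra.
move=> _ [i [B [mB ->]]]; apply: sub_sigma_algebra.
exists 1%N, (fun=> i); split; [exact: injective_ord1|exact: boxes_cylinder].
Qed.

Section relabelling.
Variable f : I -> I.
Hypothesis injf : injective f.

Definition relabel (w : prodspace I R) : prodspace I R := fun i => w (f i).

Lemma measurable_relabel : measurable_fun setT relabel.
Proof.
apply: measurable_prodspace => i _ B mB.
by rewrite setTI; exact: (measurable_evaluation (f i) mB).
Qed.

HB.instance Definition _ := isMeasurableFun.Build _ _ _ _ relabel measurable_relabel.

Lemma label_law_relabel A : measurable A ->
  label_law (relabel @^-1` A) = label_law A.
Proof.
move=> mA; rewrite -[LHS]/(distribution label_law relabel A).
apply: (@g_sigma_algebra_measure_unique _ _ _ finite_boxes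
  finite_boxes_measurable (fun=> setT)) => //.
- move=> _; exists 0%N, (fun k : 'I_0 => match notF (ltn_ord k) with end).
  by split; [case|exact: boxesT].
- by rewrite bigcup_const.
- exact: finite_boxesI.
- move=> _ [n [i [ii [B mB ->]]]].
  have ifi : injective (f \o i) by move=> a b /injf /ii.
  rewrite -[LHS]/(label_law (fbox (f \o i) B)).
  by rewrite [LHS](label_law_fbox ifi mB) [RHS](label_law_fbox ii mB).
- by move=> _; rewrite -ge0_fin_numE// fin_num_measure.
- exact: measurable_finite_boxes.
Qed.

Lemma relabel_boxes n (i : 'I_n -> I) A :
  <<s boxes i >> A -> <<s boxes (f \o i) >> (relabel @^-1` A).
Proof.
suff h : <<s boxes i >> `<=` [set A | <<s boxes (f \o i) >> (relabel @^-1` A)].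
  exact: h.
apply: smallest_sub.
  have [h0 hC hU] := smallest_sigma_algebra setT (boxes (f \o i)).
  split => /=.
  - by rewrite preimage_set0.
  - by move=> B hB; rewrite setTD preimage_setC -setTD; exact: hC.
  - by move=> F hF; rewrite preimage_bigcup; exact: hU.
move=> _ [B mB ->]; apply: sub_sigma_algebra; exists B => //.
Qed.

End relabelling.

Lemma measure_dist_le d' (T : measurableType d') (mu : probability T R) (A B : set T) :
  measurable A -> measurable B ->
  `|fine (mu A) - fine (mu B)| <= fine (mu (A `+` B)).
Proof.
move=> mA mB.
have le (C D : set T) : measurable C -> measurable D ->
    fine (mu C) - fine (mu D) <= fine (mu (C `+` D)).
  move=> mC mD; rewrite lerBlDl -lee_fin EFinD !fineK ?fin_num_measure//; last first.
    exact: measurable_setY.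
  apply: le_trans (measureU2 _ mD (measurable_setY mC mD)).
  apply: le_measure; rewrite ?inE//; first by apply: measurableU => //; exact: measurable_setY.
  by move=> x Cx; have [Dx|nD] := pselect (D x); [left|right; left].
rewrite ler_norml le// andbT lerNl opprB.
have -> : A `+` B = B `+` A by rewrite /setY setUC.
exact: le.
Qed.

(** Approximate the invariant event D by an event A that depends on finitely many
    labels, and choose g such that A and its translate A' depend on disjoint
    sets of labels. Since D is close to A, it is also close to A', hence to
    A `&` A'. So P D is close to both P A and (P A)^2, which leaves 0 and 1. *)
Lemma label_law_ergodic (Gamma : groupType) (act : Gamma -> I -> I)
    (D : set (prodspace I R)) :
  (forall g, injective (act g)) ->
  (forall n (i : 'I_n -> I), exists g, forall k l, act g (i k) <> i l) ->
  measurable D -> (forall g (w : prodspace I R), D (translate act g w) <-> D w) ->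
  label_law D = 0%E \/ label_law (~` D) = 0%E.
Proof.
move=> iact wand mD Dinv; set p := fine (label_law D).
have pE : label_law D = p%:E by rewrite fineK ?fin_num_measure.
suff : p * (1 - p) = 0.
  move=> /eqP; rewrite mulf_eq0 subr_eq0 => /orP[/eqP p0|/eqP p1]; [left|right].
    by rewrite pE p0.
  by rewrite probability_setC// pE -p1 subee.
pose Alg : set (set (prodspace I R)) :=
  [set A | exists n (i : 'I_n -> I), injective i /\ <<s boxes i >> A].
have sm k (j : 'I_k -> I) : <<s boxes j >> `<=` measurable.
  by apply: smallest_sub; [exact: sigma_algebra_measurable|exact: boxes_measurable].
have Alg_m : Alg `<=` measurable by move=> A [n [i [_ /sm]]].
have appD : approximable label_law Alg D.
  apply: algebra_approximation => //.
  - move=> A [n [i [ii Ai]]]; exists n, i; split => //.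
    by have [_ + _] := smallest_sigma_algebra setT (boxes i) => /(_ _ Ai); rewrite setTD.
  - move=> A B [n [i [ii Ai]]] [m [j [ij Bj]]].
    have [k [l [il h1 h2]]] := common_enumeration i j.
    exists k, l; split => //.
    have Al : <<s boxes l >> A.
      by apply: sub_sigma_algebra2 Ai; exact: boxes_sub.
    have Bl : <<s boxes l >> B.
      by apply: sub_sigma_algebra2 Bj; exact: boxes_sub.
    exact: (@measurableI _ (g_sigma_algebraType (boxes l))).
  - exists 0%N, (fun k : 'I_0 => match notF (ltn_ord k) with end).
    by split; [case|apply: sub_sigma_algebra; exact: boxesT].
  apply: subset_trans measurable_finite_boxes _.
  apply: sub_smallest2r; first exact: smallest_sigma_algebra.
  move=> A [n [i [ii Ai]]]; exists n, i; split => //.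
  exact: sub_sigma_algebra.
apply/eqP; rewrite -normr_eq0; apply/eqP/le_anti; rewrite normr_ge0 andbT.
apply/ler_addgt0Pr => e e0; rewrite add0r.
have e4 : 0 < e / 4 by rewrite divr_gt0.
have [A [n [i [ii Ai]]] DA] := appD.2 _ e4.
have mA := sm _ _ _ Ai.
have [g hg] := wand n i.
pose A' := relabel (act g) @^-1` A.
have mA' : measurable A'.
  by rewrite /A' -[X in measurable X]setTI; exact: measurable_relabel.
have DA' : label_law (D `+` A') = label_law (D `+` A).
  rewrite -[RHS](label_law_relabel (iact g)); last exact: measurable_setY.
  rewrite -[relabel (act g) @^-1` _]/(relabel (act g) @^-1` D `+` A').
  have -> : relabel (act g) @^-1` D = D; last by [].
  have e1 (w : prodspace I R) : relabel (act g) w = translate act g^-1%g w.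
    by apply/funext => j; rewrite /translate invgK.
  by apply/seteqP; split => w; rewrite /= e1 => /(Dinv g^-1%g w).
have AA' : label_law (A `&` A') = (label_law A * label_law A)%E.
  rewrite -[X in (_ * X)%E](label_law_relabel (iact g))//.
  apply: (@label_law_indep _ _ i (act g \o i)) => //.
  - by move=> a b /iact /ii.
  - by move=> k l /esym; exact: hg.
  - exact: relabel_boxes.
set a := fine (label_law A).
have aE : label_law A = a%:E by rewrite fineK ?fin_num_measure.
have fin B : measurable B -> label_law B \is a fin_num by exact: fin_num_measure.
have lte4 B : measurable B -> (label_law B < (e / 4)%:E)%E -> fine (label_law B) < e / 4.
  by move=> mB; rewrite -lte_fin fineK ?fin.
have h1 : `|p - a| <= e / 4.
  apply: le_trans (measure_dist_le label_law mD mA) _.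
  by apply/ltW/lte4 => //; exact: measurable_setY.
have h2 : `|p - a ^+ 2| <= e / 4 + e / 4.
  have mAA' : measurable (A `&` A') by exact: measurableI.
  have -> : a ^+ 2 = fine (label_law (A `&` A')).
    by rewrite AA' aE.
  apply: le_trans (measure_dist_le label_law mD mAA') _.
  apply: le_trans (_ : fine (label_law (D `+` A)) + fine (label_law (D `+` A')) <= _).
    rewrite -lee_fin EFinD !fineK ?fin//; try exact: measurable_setY.
    apply: le_trans (measureU2 _ (measurable_setY mD mA) (measurable_setY mD mA')).
    apply: le_measure; rewrite ?inE.
    - exact: measurable_setY.
    - by apply: measurableU; exact: measurable_setY.
    move=> w [[Dw nA]|[[Aw A'w] nD]]; last by left; right.
    by have [Aw|nAw] := pselect (A w); [right|left]; left; split => // A'w; apply: nA.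
  by apply: lerD; apply/ltW/lte4; rewrite ?DA'//; exact: measurable_setY.
have p01 : 0 <= p <= 1.
  by rewrite fine_ge0//= -lee_fin -pE probability_le1.
have a01 : 0 <= a <= 1.
  by rewrite fine_ge0//= -lee_fin -aE probability_le1.
have -> : p * (1 - p) = (p - a ^+ 2) - (p - a) * (a + p) by ring.
apply: le_trans (ler_normB _ _) _; rewrite normrM.
have -> : e = (e / 4 + e / 4) + (e / 4 * 2) by field.
apply: lerD => //; apply: ler_pM => //.
case/andP: p01 => ? ?; case/andP: a01 => ? ?.
by rewrite ger0_norm ?addr_ge0//; lra.
Qed.
End iid_labels.

(** * Translations of configurations, words in the generators *)
Section config_action.
Context (Gamma : groupType).
Local Notation shift := (translate (@lmul Gamma)).

Lemma shift1 (w : config Gamma) : shift 1%g w = w.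
Proof. by apply/funext => x; rewrite /translate /lmul invg1 mul1g. Qed.

Lemma shiftM g h (w : config Gamma) : shift (g * h)%g w = shift g (shift h w).
Proof. by apply/funext => x; rewrite /translate /lmul invgM mulgA. Qed.

Lemma measurable_shift g :
  measurable_fun setT (shift g : config Gamma -> config Gamma).
Proof.
apply: measurable_prodspace => x _ B mB; rewrite setTI.
exact: (@measurable_evaluation _ _ bool (lmul g^-1%g x) B mB).
Qed.

End config_action.

Section words.
Context (Gamma : groupType) (S : {fset Gamma}).
Hypotheses (symS : symmetric_set S) (genS : generating_set S).

Definition word_value (s : seq Gamma) : Gamma := foldr (fun x y => (x * y)%g) 1%g s.

Lemma word_value_cat s t : word_value (s ++ t) = (word_value s * word_value t)%g.
Proof. by elim: s => [|x s IH] /=; rewrite ?mul1g// IH mulgA. Qed.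

Lemma word_exists g : exists2 s, all (fun x => x \in S) s & g = word_value s.
Proof.
pose H : set Gamma := [set g | exists2 s, all (fun x => x \in S) s & g = word_value s].
suff : H g by []. suff -> : H = setT by [].
apply: genS.
- by exists [::].
- move=> x y [s hs ->] [t ht ->]; exists (s ++ t); first by rewrite all_cat hs.
  by rewrite word_value_cat.
- move=> _ [s hs ->]; exists (rev [seq x^-1%g | x <- s]).
    rewrite all_rev all_map; apply/allP => x xs /=; apply: symS.
    by move/allP: hs; apply.
  elim: s {hs} => [|x s IH] /=; first by rewrite invg1.
  by rewrite invgM rev_cons -cats1 word_value_cat IH /= mulg1.
- by move=> s sS; exists [:: s]; rewrite /= ?sS// mulg1.
Qed.

Lemma enumeration_exists : exists e : nat -> Gamma, forall g, exists n, e n = g.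
Proof.
pose e n := if (choice.unpickle n : option (seq S)) is Some s
            then word_value [seq val x | x <- s] else 1%g.
exists e => g; have [s hs ->] := word_exists g.
have [t ts] : exists t : seq S, [seq val x | x <- t] = s.
  elim: s hs => [|x s IH] /=; first by exists [::].
  by move=> /andP[xS /IH[t <-]]; exists ([` xS]%fset :: t).
by exists (choice.pickle t); rewrite /e choice.pickleK ts.
Qed.

End words.

(** * Ergodicity of factors of i.i.d. and of their weak limits *)
Section wandering.
Context (Gamma : groupType).
Hypothesis infGamma : infinite_set [set: Gamma].

Lemma lmul_injective (g : Gamma) : injective (lmul g).
Proof. exact: mulgI. Qed.

(** Only finitely many g are of the form y x^-1 with x and y in V. *)
Lemma lmul_wandering (V : seq Gamma) :
  exists g, forall x y, x \in V -> y \in V -> lmul g x <> y.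
Proof.
have : finite_set [set` [seq (y * x^-1)%g | x <- V, y <- V]] by exact: finite_seq.
move=> fV; apply: contrapT => /forallNP h; apply: infGamma.
apply: sub_finite_set fV => g _ /=.
have /existsNP[x /existsNP[y]] := h g.
move=> /not_implyP[xV /not_implyP[yV /contrapT gxy]].
apply/allpairsP; exists (x, y); split => //=.
by rewrite -gxy /lmul mulgK.
Qed.

Lemma edge_act_injective (S : {fset Gamma}) g : injective (@edge_act Gamma S g).
Proof.
move=> [e he] [f hf] /(congr1 sval) /= ef.
have : e = f.
  apply/seteqP; split => x ex.
    have : (lmul g @` f) (lmul g x) by rewrite -ef; exists x.
    by move=> [y fy /lmul_injective <-].
  have : (lmul g @` e) (lmul g x) by rewrite ef; exists x.
  by move=> [y fy /lmul_injective <-].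
by move=> eef; move: he hf; rewrite eef => he hf; rewrite (Prop_irrelevance he hf).
Qed.

(** If g maps an edge to an edge, it maps endpoints to endpoints; so it suffices
    to move the finite set of all endpoints off itself. *)
Lemma edge_act_wandering (S : {fset Gamma}) n (i : 'I_n -> edge S) :
  exists g, forall k l, edge_act g (i k) <> i l.
Proof.
have ex k : exists y, sval (i k) y.
  by have [y [z [_ ->]]] := svalP (i k); exists y; left.
have ey k : exists s : seq Gamma, sval (i k) `<=` [set` s].
  have [y [z [_ ->]]] := svalP (i k); exists [:: y; z] => t [] -> /=.
    by rewrite inE eqxx.
  by rewrite !inE eqxx orbT.
have [x hx] := choice ex; have [y hy] := choice ey.
have [g hg] := lmul_wandering (flatten [seq y k | k <- enum 'I_n]).
exists g => k l /(congr1 sval) /= e.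
have : sval (i l) (lmul g (x k)) by rewrite -e; exists (x k).
move=> /(hy l) /= ml; apply: (hg (x k) (lmul g (x k))) => //.
  by apply/flatten_mapP; exists k; rewrite ?mem_enum//; exact: (hy k).
by apply/flatten_mapP; exists l; rewrite ?mem_enum.
Qed.

Lemma lmul_wandering_ord n (i : 'I_n -> Gamma) :
  exists g, forall k l, lmul g (i k) <> i l.
Proof.
have [g hg] := lmul_wandering [seq i k | k <- enum 'I_n].
by exists g => k l; apply: hg; rewrite map_f ?mem_enum.
Qed.

End wandering.

Section fiid_ergodic.
Context (R : realType) (Gamma : groupType).
Local Notation shift := (translate (@lmul Gamma)).

(** Both properties hold for i.i.d. labels and pass to equivariant images. *)
Lemma fiid_from_invariant_ergodic (I : Type) (act : Gamma -> I -> I)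
    (mu : probability (config Gamma) R) :
  (forall g, injective (act g)) ->
  (forall n (i : 'I_n -> I), exists g, forall k l, act g (i k) <> i l) ->
  fiid_law_from act mu ->
  site_percolation_law mu /\
  act_ergodic mu (shift : Gamma -> config Gamma -> config Gamma).
Proof.
move=> iact wand [d [W [P [U [F [iidU [mF eqF] muE]]]]]].
have muL A : measurable A -> mu A = label_law U (F @^-1` A).
  by move=> mA; rewrite muE.
have mFA A : measurable A -> measurable (F @^-1` A).
  by move=> mA; rewrite -[X in measurable X]setTI; exact: mF.
split.
  move=> g A mA; rewrite !muL//; last first.
    by rewrite -[X in measurable X]setTI; exact: measurable_shift.
  rewrite -(label_law_relabel iidU (iact g^-1%g) (mFA _ mA)).
  congr (label_law U _); apply/seteqP; split => w /=; rewrite -eqF;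
    by rewrite (_ : translate act g w = relabel (act g^-1%g) w).
move=> A mA Ainv.
have [g w /=|A0|A0] := label_law_ergodic iidU iact wand (mFA _ mA).
- by rewrite eqF; exact: Ainv.
- by left; rewrite -A0; exact: muL.
- by right; rewrite -A0; apply: muL; exact: measurableC.
Qed.

Lemma fiid_invariant_ergodic (S : {fset Gamma}) (mu : probability (config Gamma) R) :
  infinite_set [set: Gamma] -> fiid_law S mu ->
  site_percolation_law mu /\
  act_ergodic mu (shift : Gamma -> config Gamma -> config Gamma).
Proof.
move=> infG [ | ]; apply: fiid_from_invariant_ergodic.
- exact: lmul_injective.
- exact: lmul_wandering_ord.
- exact: edge_act_injective.
- exact: edge_act_wandering.
Qed.

End fiid_ergodic.

Section weak_limit.
Context (R : realType) (Gamma : groupType).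
Local Notation shift := (translate (@lmul Gamma)).

(** The indicator of A as a function on {0,1}^Gamma with its product topology. *)
Definition cindic (A : set (config Gamma)) (w : {ptws Gamma -> bool}) : R :=
  \1_A (w : config Gamma).

(** On these sets weak convergence is convergence of measures, and they form an
    algebra that generates the sigma-algebra. *)
Definition clopen_config : set (set (config Gamma)) :=
  [set A : set (config Gamma) | measurable A /\ continuous (cindic A)].

Lemma clopen_configC A : clopen_config A -> clopen_config (~` A).
Proof.
move=> [mA cA]; split; first exact: measurableC.
have -> : cindic (~` A) = (fun w => 1 - cindic A w).
  by apply/funext => w; rewrite /cindic !indicE in_setC; case: (w \in A); rewrite ?subrr ?subr0.
by move=> w; apply: cvgB; [exact: cvg_cst|exact: cA].
Qed.

Lemma clopen_configI A B : clopen_config A -> clopen_config B ->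
  clopen_config (A `&` B).
Proof.
move=> [mA cA] [mB cB]; split; first exact: measurableI.
have -> : cindic (A `&` B) = (fun w => cindic A w * cindic B w).
  by apply/funext => w; rewrite /cindic !indicE in_setI; case: (w \in A); rewrite ?mul1r ?mul0r.
by move=> w; apply: cvgM; [exact: cA|exact: cB].
Qed.

Lemma clopen_configT : clopen_config setT.
Proof.
split => //; rewrite (_ : cindic setT = cst 1); last by apply/funext => w; rewrite /cindic indicT.
exact: cst_continuous.
Qed.

Lemma clopen_configY A B : clopen_config A -> clopen_config B ->
  clopen_config (A `+` B).
Proof.
move=> cA cB; rewrite /setY !setDE -[X in clopen_config X]setCK setCU.
by apply/clopen_configC/clopen_configI;
  apply/clopen_configC/clopen_configI => //; exact: clopen_configC.
Qed.

Lemma shift_continuous g :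
  continuous (shift g : {ptws Gamma -> bool} -> {ptws Gamma -> bool}).
Proof.
move=> w; apply/cvg_sup => x U [V [[W oW <-] Ww WU]].
apply: filterS WU _.
apply: (@proj_continuous _ (fun=> bool) (lmul g^-1%g x) w).
exact: open_nbhs_nbhs.
Qed.

Lemma clopen_config_shift g A : clopen_config A -> clopen_config (shift g @^-1` A).
Proof.
move=> [mA cA]; split.
  by rewrite -[X in measurable X]setTI; exact: measurable_shift.
have -> : cindic (shift g @^-1` A) = cindic A \o shift g.
  by apply/funext => w; rewrite /= /cindic !indicE; congr (_%:R); apply/idP/idP; rewrite !inE.
by move=> w; apply: continuous_comp; [exact: shift_continuous|exact: cA].
Qed.

Lemma clopen_config_cylinder x (B : set bool) :
  clopen_config [set w | B (w x)].
Proof.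
split; first exact: (@measurable_evaluation _ _ bool x B).
have -> : cindic [set w | B (w x)] =
    (fun b : bool => \1_B b) \o (fun w : {ptws Gamma -> bool} => w x).
  by apply/funext => w; rewrite /= /cindic !indicE; congr (_%:R); apply/idP/idP; rewrite !inE.
move=> w; apply: continuous_comp; first exact: (@proj_continuous _ (fun=> bool) x).
move=> U /nbhs_singleton h; rewrite nbhs_principalE nbhs_simpl.
exact/principal_filterP.
Qed.

Lemma clopen_config_dense (mu : probability (config Gamma) R) D :
  measurable D -> approximable mu clopen_config D.
Proof.
apply: algebra_approximation.
- by move=> A [].
- exact: clopen_configC.
- exact: clopen_configI.
- exact: clopen_configT.
apply: smallest_sub; first exact: smallest_sigma_algebra.
move=> _ [x [B [mB ->]]]; apply: sub_sigma_algebra.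
exact: clopen_config_cylinder.
Qed.

Lemma weak_cvg_clopen (mu_ : nat -> probability (config Gamma) R)
    (mu : probability (config Gamma) R) A :
  weak_cvg mu_ mu -> clopen_config A ->
  fine (mu_ n A) @[n --> \oo] --> fine (mu A).
Proof.
move=> cmu [mA cA].
have E (nu : probability (config Gamma) R) :
    (\int[nu]_w (cindic A w)%:E = nu A)%E by rewrite integral_indic// setIT.
have := cmu _ cA; rewrite E -[X in _ --> X]fineK ?fin_num_measure//.
have -> : (fun n => \int[mu_ n]_w (cindic A w)%:E)%E = (fun n => mu_ n A).
  by apply/funext => n; exact: E.
have bA : exists M : R, forall w, `|cindic A w| <= M.
  by exists 1 => w; rewrite /cindic indicE normr_nat; case: (_ \in _).
by move=> /(_ bA) /fine_cvg.
Qed.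

Lemma cvg_sum_seq (I : Type) (s : seq I) (f : I -> nat -> R) (l : I -> R) :
  (forall i, f i n @[n --> \oo] --> l i) ->
  (\sum_(i <- s) f i n) @[n --> \oo] --> \sum_(i <- s) l i.
Proof.
move=> fl; elim: s => [|i s IH].
  by rewrite big_nil; under eq_fun do rewrite big_nil; exact: cvg_cst.
by rewrite big_cons; under eq_fun do rewrite big_cons; exact: cvgD.
Qed.

Variables (S : {fset Gamma}) (Q : {fset Gamma}) (eps : R).
Hypotheses (infG : infinite_set [set: Gamma]).
Hypotheses (symS : symmetric_set S) (genS : generating_set S).
Hypotheses (eps_gt0 : 0 < eps) (kp : kazhdan_pair Q eps).

Local Notation shift_config := (shift : Gamma -> config Gamma -> config Gamma).

Lemma percolation_spectral_gap (mu : probability (config Gamma) R) E :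
  site_percolation_law mu -> act_ergodic mu shift_config -> measurable E ->
  eps ^+ 2 * (fine (mu E) * fine (mu (~` E))) <=
  \sum_(g <- Q) fine (mu ((shift_config g^-1%g @^-1` E) `+` E)).
Proof.
move=> inv erg mE; have [e esurj] := enumeration_exists symS genS.
have Tfin : (mu setT < +oo)%E by rewrite probability_setT ltry.
have := @spectral_gap _ _ _ mu _ shift_config (@shift1 Gamma) (@shiftM Gamma)
  (@measurable_shift Gamma) inv e esurj Q eps E eps_gt0 kp Tfin erg mE.
move=> h; apply: (le_trans h); rewrite -[leRHS]mul1r le_eqVlt.
by apply/orP; left; apply/eqP; congr (_ * _); exact: (congr1 fine (probability_setT mu)).
Qed.

(** Weak limits of ergodic laws need not be ergodic in general. Here the spectral
    gap, whose constants are those of the Kazhdan pair, survives in the limit for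
    clopen sets. An invariant set D is approximated by clopen sets, for which
    the right-hand side is then small, so that D is trivial. *)
Lemma weak_fiid_ergodic (mu : probability (config Gamma) R) :
  site_percolation_law mu -> weak_fiid_law S mu -> act_ergodic mu shift_config.
Proof.
move=> inv [mu_ [fmu cmu]] D mD Dinv.
have gap E : clopen_config E ->
    eps ^+ 2 * (fine (mu E) * fine (mu (~` E))) <=
    \sum_(g <- Q) fine (mu ((shift_config g^-1%g @^-1` E) `+` E)).
  move=> cE; have cl g : clopen_config ((shift_config g^-1%g @^-1` E) `+` E).
    by apply: clopen_configY => //; exact: clopen_config_shift.
  apply: (@ler_cvg_to _ \oo _ _
    (fun n => eps ^+ 2 * (fine (mu_ n E) * fine (mu_ n (~` E))))
    (fun n => \sum_(g <- Q) fine (mu_ n ((shift_config g^-1%g @^-1` E) `+` E)))).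
  - apply: cvgM; first exact: cvg_cst.
    by apply: cvgM; apply: weak_cvg_clopen => //; exact: clopen_configC.
  - by apply: cvg_sum_seq => g; exact: weak_cvg_clopen.
  apply: nearW => n; have [invn ergn] := fiid_invariant_ergodic infG (fmu n).
  by apply: percolation_spectral_gap => //; case: cE.
have fin A : measurable A -> mu A \is a fin_num by exact: fin_num_measure.
set p := fine (mu D).
have pE : mu D = p%:E by rewrite fineK ?fin.
suff : eps ^+ 2 * (p * (1 - p)) <= 0.
  rewrite pmulr_rle0 ?exprn_gt0// => h.
  have p01 : 0 <= p <= 1 by rewrite fine_ge0//= -lee_fin -pE probability_le1.
  have : p * (1 - p) == 0.
    by rewrite eq_le h mulr_ge0 ?subr_ge0//; case/andP: p01.
  rewrite mulf_eq0 subr_eq0 => /orP[/eqP p0|/eqP p1]; [left|right].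
    by rewrite [LHS]pE p0.
  by transitivity (1 - mu D)%E; [exact: probability_setC|rewrite pE -p1 subee].
apply/ler_addgt0Pr => c c0; rewrite add0r.
pose q : R := (size Q)%:R.
have q0 : 0 <= q by rewrite ler0n.
(* Replacing D by a clopen set within t costs at most t + t on the left-hand
   side and for each element of Q; this t makes the total error equal to c. *)
pose t := c / (2 * (q + eps ^+ 2)).
have qe : 0 < q + eps ^+ 2 by rewrite ltr_wpDl// exprn_gt0.
have t0 : 0 < t by rewrite divr_gt0// mulr_gt0.
have [E cE DE] := (clopen_config_dense mu mD).2 _ t0.
have mE : measurable E by case: cE.
have mDE := measurable_setY mD mE.
have DE' : fine (mu (D `+` E)) <= t.
  by rewrite -lee_fin fineK ?fin// ltW.
have pE1 : `|p - fine (mu E)| <= t.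
  by apply: le_trans (measure_dist_le mu mD mE) DE'.
have pE2 : fine (mu (~` E)) = 1 - fine (mu E).
  by rewrite probability_setC// fineB ?fin.
have bound g : fine (mu ((shift_config g^-1%g @^-1` E) `+` E)) <= t + t.
  have msE : measurable (shift_config g^-1%g @^-1` (D `+` E)).
    by rewrite -[X in measurable X]setTI; exact: measurable_shift.
  have mgE : measurable (shift_config g^-1%g @^-1` E).
    by rewrite -[X in measurable X]setTI; exact: measurable_shift.
  rewrite -lee_fin EFinD fineK; last by apply: fin; exact: measurable_setY.
  have h1 : (mu (D `+` E) <= t%:E)%E by exact: ltW.
  apply: le_trans (leeD h1 h1); rewrite -[X in (X + _)%E](inv g^-1%g)//.
  apply: le_trans (measureU2 _ msE mDE).
  apply: le_measure; rewrite ?inE.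
  - exact: measurable_setY.
  - exact: measurableU.
  move=> w [[Egw nE]|[Ew nE]].
    have [Dw|nD] := pselect (D w); first by right; left.
    by left; right; split => //= /Dinv.
  have [Dw|nD] := pselect (D w); last by right; right.
  by left; left; split => //=; apply/Dinv.
have := gap E cE; rewrite pE2; set r := fine (mu E) in pE1 *.
move=> h; have : \sum_(g <- Q) fine (mu ((shift_config g^-1%g @^-1` E) `+` E))
    <= q * (t + t).
  apply: le_trans (_ : \sum_(g <- Q) (t + t) <= _); first exact: ler_sum.
  by rewrite big_const_seq count_predT iter_addr_0 mulr_natl.
move=> /(le_trans h) {}h.
have r01 : 0 <= r <= 1.
  by rewrite fine_ge0//= -lee_fin fineK ?fin// probability_le1.
have p01 : 0 <= p <= 1 by rewrite fine_ge0//= -lee_fin -pE probability_le1.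
have ct : c = (q + eps ^+ 2) * (t + t).
  by rewrite /t; field; rewrite gt_eqF.
rewrite ct mulrDl; apply: le_trans (_ : eps ^+ 2 * (r * (1 - r)) + eps ^+ 2 * (t + t) <= _).
  rewrite -mulrDr ler_pM2l ?exprn_gt0//.
  rewrite -lerBlDl (_ : p * (1 - p) - r * (1 - r) = (p - r) * (1 - p - r)); last by ring.
  apply: le_trans (ler_norm _) _; rewrite normrM.
  apply: le_trans (_ : t * 1 <= _); last by rewrite mulr1 lerDl ltW.
  apply: ler_pM => //.
  by rewrite ler_norml; case/andP: p01 => ? ?; case/andP: r01 => ? ?; apply/andP; split; lra.
by rewrite lerD2r.
Qed.

Lemma fiid_or_weak_ergodic (mu : probability (config Gamma) R) :
  site_percolation_law mu -> fiid_law S mu \/ weak_fiid_law S mu ->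
  act_ergodic mu shift_config.
Proof.
move=> inv [/(fiid_invariant_ergodic infG)[]//|].
exact: weak_fiid_ergodic.
Qed.
End weak_limit.

(** * Clusters *)
Section cluster_combinatorics.
Context (Gamma : groupType) (S : {fset Gamma}).
Hypothesis symS : symmetric_set S.
Local Notation shift := (translate (@lmul Gamma)).
Local Notation cl := (@cluster_of Gamma S).
Implicit Types (w : config Gamma) (x y z g : Gamma).

Lemma adj_sym x y : adj S x y -> adj S y x.
Proof.
move=> /imfsetP[s /=]; rewrite !inE => /andP[s1 sS] ->.
apply/imfsetP; exists s^-1%g => /=; last by rewrite mulgK.
by rewrite !inE invg_eq1 s1 symS.
Qed.

Lemma induced_adj_sym w x y : induced_adj S w x y -> induced_adj S w y x.
Proof. by move=> /and3P[wx wy xy]; rewrite /induced_adj wx wy adj_sym. Qed.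

Lemma clP w x y : cl w x y <->
  w x /\ exists p, path (induced_adj S w) x p /\ last x p = y.
Proof.
split; first by move=> /andP[wx /asboolP].
by move=> [wx h]; apply/andP; split => //; apply/asboolP.
Qed.

Lemma cl_refl w x : w x -> cl w x x.
Proof. by move=> wx; apply/clP; split => //; exists [::]. Qed.

Lemma cl_mem w x y : cl w x y -> w y.
Proof.
move=> /clP[wx [p [+ <-]]]; elim: p x wx => //= z p IH x wx /andP[/and3P[_ wz _]].
exact: IH.
Qed.

Lemma cl_trans w x y z : cl w x y -> cl w y z -> cl w x z.
Proof.
move=> /clP[wx [p [hp lp]]] /clP[wy [q [hq lq]]]; apply/clP; split => //.
by exists (p ++ q); rewrite cat_path last_cat lp hp.
Qed.

Lemma cl_adj w x y : w x -> w y -> adj S x y -> cl w x y.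
Proof.
move=> wx wy xy; apply/clP; split => //; exists [:: y] => /=.
by rewrite /induced_adj wx wy xy.
Qed.

Lemma cl_sym w x y : cl w x y -> cl w y x.
Proof.
move=> /clP[wx [p [+ <-]]]; elim: p x wx => [|z p IH] x wx /=.
  by move=> _; exact: cl_refl.
move=> /andP[xz hp]; have /and3P[_ wz _] := xz.
apply: cl_trans (IH _ wz hp) _.
by have /and3P[? ? ?] := induced_adj_sym xz; exact: cl_adj.
Qed.

Lemma cl_eq w x y : cl w x y -> cl w x = cl w y.
Proof.
move=> xy; apply/funext => z; apply/idP/idP.
  by apply: cl_trans; exact: cl_sym.
exact: cl_trans.
Qed.

Lemma adj_shift g x y : adj S (lmul g x) (lmul g y) = adj S x y.
Proof.
apply/idP/idP; last exact: adj_lmul.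
by move=> /(@adj_lmul _ _ g^-1%g); rewrite /lmul !mulKg.
Qed.

Lemma shiftE g w x : shift g w (lmul g x) = w x.
Proof. by rewrite /translate /lmul mulKg. Qed.

Lemma path_shift g w x p : path (induced_adj S w) x p ->
  path (induced_adj S (shift g w)) (lmul g x) [seq lmul g y | y <- p].
Proof.
elim: p x => //= y p IH x /andP[/and3P[wx wy xy] /IH ->].
by rewrite /induced_adj !shiftE adj_shift wx wy xy.
Qed.

Lemma cl_shift_sub g w x y : cl w x y -> cl (shift g w) (lmul g x) (lmul g y).
Proof.
move=> /clP[wx [p [hp <-]]]; apply/clP; rewrite shiftE; split => //.
by exists [seq lmul g y | y <- p]; rewrite last_map; split => //; exact: path_shift.
Qed.

Lemma cl_shift g w x : cl (shift g w) (lmul g x) = shift g (cl w x).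
Proof.
apply/funext => y; rewrite -{1}[y](mulVKg g) -/(lmul g (g^-1 * y)%g).
rewrite -[RHS]/(cl w x (g^-1 * y)%g).
apply/idP/idP; last exact: cl_shift_sub.
move=> /(cl_shift_sub g^-1%g).
by rewrite -shiftM mulVg shift1 /lmul !mulKg.
Qed.

Lemma measurable_site x : measurable [set w : config Gamma | w x].
Proof. exact: measurable_coord. Qed.

(** Fixing the length of the path allows an induction for measurability. *)
Definition reach n w x y :=
  exists p, [/\ size p = n, path (induced_adj S w) x p & last x p = y].

Lemma reachS n w x y : reach n.+1 w x y <->
  exists2 z, z \in nbrs S x & w x /\ w z /\ reach n w z y.
Proof.
split.
  move=> [[|z p] []] //= [sp] /andP[/and3P[wx wz xz] hp] lp.
  by exists z => //; do 2 split => //; exists p.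
move=> [z xz [wx [wz [p [sp hp lp]]]]]; exists (z :: p); split => /=.
- by rewrite sp.
- by rewrite /induced_adj wx wz hp andbT.
- exact: lp.
Qed.

Lemma measurable_reach n x y : measurable [set w : config Gamma | reach n w x y].
Proof.
elim: n x => [|n IH] x.
  have [->|xy] := eqVneq x y.
    rewrite (_ : [set _ | _] = setT)//; apply/seteqP; split => // w _ /=.
    by exists [::].
  rewrite (_ : [set _ | _] = set0)//; apply/seteqP; split => // w.
  by move=> [[|z p] []] //= _ _ e; rewrite e eqxx in xy.
rewrite (_ : [set _ | _] = \bigcup_(z in [set` nbrs S x])
   ([set w : config Gamma | w x] `&` ([set w : config Gamma | w z] `&`
    [set w | reach n w z y]))).
  apply: fin_bigcup_measurable; first exact: finite_fset.
  move=> z _; apply: measurableI; first exact: measurable_site.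
  by apply: measurableI; [exact: measurable_site|exact: IH].
apply/seteqP; split => w /=.
  by move=> /reachS[z xz h]; exists z.
by move=> [z xz h]; apply/reachS; exists z.
Qed.

Lemma measurable_cluster_of x : measurable_fun setT (fun w : config Gamma => cl w x).
Proof.
apply: measurable_prodspace => y; apply: (@measurable_fun_bool _ _ setT _ true).
rewrite setTI (_ : _ @^-1` _ = [set w : config Gamma | w x] `&`
  \bigcup_n [set w | reach n w x y]).
  apply: measurableI; first exact: measurable_site.
  by apply: bigcupT_measurable => n; exact: measurable_reach.
apply/seteqP; split => w /=.
  by move=> /clP[wx [p [hp lp]]]; split => //; exists (size p) => //; exists p.
by move=> [wx [n _ [p [_ hp lp]]]]; apply/clP; split => //; exists p.
Qed.

End cluster_combinatorics.

(** * The intensity measure of the clusters *)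
Section intensity.
Context (R : realType) (Gamma : groupType) (S : {fset Gamma}).
Hypothesis symS : symmetric_set S.
Variable e : nat -> Gamma.
Hypothesis esurj : forall g, exists n, e n = g.
Variable mu : probability (config Gamma) R.
Hypothesis inv : site_percolation_law mu.
Local Notation shift := (translate (@lmul Gamma)).
Local Notation shift_config := (shift : Gamma -> config Gamma -> config Gamma).
Implicit Types (w C : config Gamma) (x y z g : Gamma) (B : set (config Gamma)).

(** The arguments are in this order because the cluster is studied as a random
    variable, for a fixed vertex. *)
Definition clmap x w : config Gamma := cluster_of S w x.

Lemma measurable_clmap x : measurable_fun setT (clmap x).
Proof. exact: measurable_cluster_of. Qed.

Lemma measurable_clmap_set x B : measurable B -> measurable [set w : config Gamma | B (clmap x w)].
Proof.
by move=> mB; rewrite -[X in measurable X]setTI; exact: measurable_clmap.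
Qed.

(** The event that e n is the first vertex of its cluster in the enumeration e,
    so that each cluster is counted once. *)
Definition representative n : set (config Gamma) :=
  [set w : config Gamma | w (e n) /\ forall k, (k < n)%N -> ~ clmap (e n) w (e k)].

Lemma measurable_representative n : measurable (representative n).
Proof.
rewrite (_ : representative n = [set w : config Gamma | w (e n)] `&`
    \bigcap_(k in `I_n) ~` [set w : config Gamma | clmap (e n) w (e k)]).
  apply: measurableI; first exact: measurable_site.
  apply: fin_bigcap_measurable => // k _; apply: measurableC.
  exact: (measurable_clmap_set _ (measurable_site (e k))).
by apply/seteqP; split.
Qed.

Definition cluster_at n B : set (config Gamma) :=
  [set w : config Gamma | B (clmap (e n) w)] `&` representative n.

Lemma measurable_cluster_at n B : measurable B -> measurable (cluster_at n B).
Proof.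
move=> mB; apply: measurableI; first exact: measurable_clmap_set.
exact: measurable_representative.
Qed.

Definition cluster_at_measure n B : \bar R := mu (cluster_at n B).

Let cluster_at0 n : cluster_at_measure n set0 = 0%E.
Proof. by rewrite /cluster_at_measure /cluster_at set0I measure0. Qed.

Let cluster_at_ge0 n B : (0 <= cluster_at_measure n B)%E.
Proof. exact: measure_ge0. Qed.

Let cluster_at_sigma_additive n : semi_sigma_additive (cluster_at_measure n).
Proof.
move=> F mF tF mUF; rewrite /cluster_at_measure.
have -> : cluster_at n (\bigcup_k F k) = \bigcup_k cluster_at n (F k).
  by rewrite /cluster_at -setI_bigcupl; congr (_ `&` _); apply/seteqP; split.
apply: measure_semi_sigma_additive.
- by move=> k; exact: measurable_cluster_at.
- move=> k l _ _ [w [[h1 _] [h2 _]]]; apply: (tF k l) => //.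
  by exists (clmap (e n) w).
- by apply: bigcupT_measurable => k; exact: measurable_cluster_at.
Qed.

HB.instance Definition _ n := isMeasure.Build _ _ _ (cluster_at_measure n)
  (cluster_at0 n) (cluster_at_ge0 n) (@cluster_at_sigma_additive n).

(** Each term is the expectation of the number, 0 or 1, of clusters in B whose
    first vertex is e n; see [integral_cluster_count] for the sum. *)
Definition intensity : {measure set (config Gamma) -> \bar R} :=
  mseries cluster_at_measure 0.

Lemma intensityE B : intensity B = (\sum_(n <oo) mu (cluster_at n B))%E.
Proof. by []. Qed.

Definition cluster_count B w : \bar R :=
  (\esum_(C in [set C : config Gamma | is_cluster S w C /\ B C]) 1)%E.

Lemma cluster_countE B w :
  (\sum_(n <oo) (\1_(cluster_at n B) w : R)%:E)%E = cluster_count B w.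
Proof.
rewrite nneseries_esumT; last by move=> n; rewrite lee_fin indicE ler0n.
rewrite /cluster_count.
rewrite (@reindex_esum R nat (config Gamma) [set n | cluster_at n B w] _
  (fun n => clmap (e n) w) (fun=> 1%E)).
  rewrite [RHS]esum_mkcond; apply: eq_esum => n _; rewrite indicE.
  have [h|h] := pselect (cluster_at n B w).
    by rewrite !mem_set.
  by rewrite !memNset.
split.
- move=> n [Bn [wn _]]; split => //; by exists (e n).
- move=> n m; rewrite !inE => -[_ [wn hn]] [_ [wm hm]] eqC.
  have [nm|mn|//] := ltngtP n m.
    by case: (hm n nm); rewrite -eqC; exact: cl_refl.
  by case: (hn m mn); rewrite eqC; exact: cl_refl.
move=> C [[x [wx ->]] BC].
have ex : exists n, cluster_of S w x (e n).
  by have [n en] := esurj x; exists n; rewrite en; exact: cl_refl.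
have [n xn nmin] := ex_minnP ex.
have Cn : cluster_of S w x = cluster_of S w (e n) by exact: cl_eq.
exists n; last exact/esym.
split; first by rewrite /= /clmap -Cn.
split; first exact: cl_mem xn.
move=> k kn; rewrite /clmap -Cn => /nmin; rewrite leqNgt kn.
by [].
Qed.

Lemma integral_cluster_count B : measurable B ->
  (\int[mu]_w cluster_count B w = intensity B)%E.
Proof.
move=> mB; rewrite intensityE.
under eq_integral do rewrite -cluster_countE.
rewrite integral_nneseries//.
- by apply: eq_eseriesr => n _; rewrite integral_indic ?setIT//; exact: measurable_cluster_at.
- by move=> n; apply/measurable_EFinP; apply: measurable_indic; exact: measurable_cluster_at.
Qed.

Lemma measurable_cluster_count B : measurable B ->
  measurable_fun setT (cluster_count B).
Proof.
move=> mB; rewrite (_ : cluster_count B =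
    (fun w => \sum_(n <oo) (\1_(cluster_at n B) w : R)%:E)%E); last first.
  by apply/funext => w; rewrite cluster_countE.
apply: ge0_emeasurable_sum => [n w _ _|n _].
  by rewrite lee_fin indicE ler0n.
by apply/measurable_EFinP; apply: measurable_indic; exact: measurable_cluster_at.
Qed.

Lemma cluster_count_shift g B w :
  cluster_count (shift g @^-1` B) w = cluster_count B (shift g w).
Proof.
apply/esym; rewrite /cluster_count.
apply: (@reindex_esum R (config Gamma) (config Gamma) _ _ (shift_config g) (fun=> 1%E)).
have shiftK C : shift g^-1%g (shift g C) = C by rewrite -shiftM mulVg shift1.
have shiftVK C : shift g (shift g^-1%g C) = C by rewrite -shiftM mulgV shift1.
split.
- move=> C [[x [wx ->]] BC]; split => //; exists (lmul g x).
  by rewrite shiftE cl_shift.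
- by move=> C D _ _ CD; rewrite -(shiftK C) CD shiftK.
move=> C [[x [wx Cx]] BC]; exists (shift g^-1%g C); last exact: shiftVK.
split; last by rewrite /= shiftVK.
exists (lmul g^-1%g x); split; first by move: wx.
by rewrite -{1}(shiftK w) cl_shift -Cx.
Qed.

(** A translation maps the clusters of a configuration to those of its translate,
    and mu is invariant. *)
Lemma intensity_shift g B : measurable B ->
  intensity (shift_config g @^-1` B) = intensity B.
Proof.
move=> mB; rewrite -!integral_cluster_count//; last first.
  by rewrite -[X in measurable X]setTI; exact: measurable_shift.
under eq_integral do rewrite cluster_count_shift.
apply: (ge0_integral_act (@measurable_shift Gamma) inv).
- exact: measurable_cluster_count.
- by move=> w; exact: esum_ge0.
Qed.

(** At most one cluster contains x, so that the expected number of clusters in B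
    through x is a probability. *)
Lemma intensity_site x B : measurable B ->
  intensity (B `&` [set C : config Gamma | C x]) =
  mu [set w : config Gamma | B (clmap x w) /\ w x].
Proof.
move=> mB; have mBx := measurableI _ _ mB (measurable_site x).
have Ux : \bigcup_n cluster_at n (B `&` [set C : config Gamma | C x]) =
    [set w : config Gamma | B (clmap x w) /\ w x].
  apply/seteqP; split => w.
    move=> [n _ [[Bn xn] _]]; have en := cl_eq symS xn.
    by split; [rewrite /clmap -en|exact: cl_mem xn].
  move=> [Bx wx].
  have ex : exists n, cluster_of S w x (e n).
    by have [n en] := esurj x; exists n; rewrite en; exact: cl_refl.
  have [n xn nmin] := ex_minnP ex.
  have Cn : cluster_of S w x = cluster_of S w (e n) by exact: cl_eq.
  exists n => //; split; split.
  - by rewrite /clmap -Cn.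
  - by rewrite /= /clmap -Cn; exact: cl_refl.
  - exact: cl_mem xn.
  by move=> k kn; rewrite /clmap -Cn => /nmin; rewrite leqNgt kn.
rewrite intensityE -Ux measure_semi_bigcup//.
- by move=> n; exact: measurable_cluster_at.
- move=> n m _ _ [w [[[_ xn] [wn hn]] [[_ xm] [wm hm]]]].
  have eqC : clmap (e n) w = clmap (e m) w.
    by rewrite /clmap (cl_eq symS xn) (cl_eq symS xm).
  have [nm|mn|//] := ltngtP n m.
    by case: (hm n nm); rewrite -eqC; exact: cl_refl.
  by case: (hn m mn); rewrite eqC; exact: cl_refl.
- by apply: bigcupT_measurable => n; exact: measurable_cluster_at.
Qed.

Lemma intensity_eq0 B : measurable B ->
  (forall x, intensity (B `&` [set C : config Gamma | C x]) = 0%E) ->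
  intensity B = 0%E.
Proof.
move=> mB h; rewrite intensityE eseries0// => n _ _.
apply/eqP; rewrite eq_le measure_ge0 andbT -(h (e n)) intensity_site//.
apply: le_measure; rewrite ?inE.
- exact: measurable_cluster_at.
- by apply: measurableI; [exact: measurable_clmap_set|exact: measurable_site].
by move=> w [Bw [wn _]].
Qed.

Lemma cluster_count_ge2 B w C D : C <> D -> is_cluster S w C -> B C ->
  is_cluster S w D -> B D -> (2%:E <= cluster_count B w)%E.
Proof.
move=> CD cC BC cD BD; apply: esum_ge; exists [set C; D].
  split; first by rewrite finite_setU; split; exact: finite_set1.
  by move=> _ [] ->.
rewrite fsbigU//=; last by move=> z [-> /= /CD].
by rewrite !fsbig_set1.
Qed.

(** The intensity of this set is the one-sided distance, in L1 of the intensity,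
    from the indicator of the clusters in B through x to that of the clusters in
    B through y. It is invariant and satisfies the triangle inequality. *)
Definition separating B x y : set (config Gamma) :=
  B `&` [set C : config Gamma | C x /\ ~ C y].

Lemma measurable_separating B x y : measurable B -> measurable (separating B x y).
Proof.
move=> mB; apply: measurableI => //.
rewrite (_ : [set _ | _] = [set C : config Gamma | C x] `&` ~` [set C : config Gamma | C y]).
  by apply: measurableI; [|apply: measurableC]; exact: measurable_site.
by apply/seteqP; split.
Qed.

Lemma intensity_separating_triangle B x y z : measurable B ->
  (intensity (separating B x z) <=
   intensity (separating B x y) + intensity (separating B y z))%E.
Proof.
move=> mB; have ms u v := measurable_separating u v mB.
apply: le_trans (measureU2 _ (ms x y) (ms y z)).
apply: le_measure; rewrite ?inE//; first exact: measurableU.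
move=> C [BC [Cx nCz]].
by have [Cy|nCy] := pselect (C y); [right|left].
Qed.

Lemma intensity_separating_shift B g x y : measurable B ->
  act_invariant shift_config B ->
  intensity (separating B (g * x)%g (g * y)%g) = intensity (separating B x y).
Proof.
move=> mB Binv; rewrite -[LHS](intensity_shift g); last exact: measurable_separating.
have sE (C : config Gamma) z : shift g C (g * z)%g = C z by exact: shiftE.
congr (intensity _); apply/seteqP; split => C.
  by move=> [BC]; rewrite /= !sE => h; split => //; apply/(Binv g).
by move=> [BC h]; split; [apply/(Binv g)|rewrite /= !sE].
Qed.

(** Follow the path from 1 to the value of t, one generator at a time. *)
Lemma intensity_separating_word B (c : R) (t : seq Gamma) : measurable B ->
  act_invariant shift_config B ->
  (forall s, s \in S -> (intensity (separating B 1%g s) <= c%:E)%E) ->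
  all (fun s => s \in S) t ->
  (intensity (separating B 1%g (word_value t)) <= ((size t)%:R * c)%:E)%E.
Proof.
move=> mB Binv hc; elim: t => [_|s t IH] /=.
  rewrite mul0r (_ : separating B _ _ = set0) ?measure0//.
  by apply/seteqP; split => // C [_ []].
move=> /andP[sS /IH h].
apply: le_trans (intensity_separating_triangle 1%g s _ mB) _.
have := intensity_separating_shift s 1%g (word_value t) mB Binv.
rewrite mulg1 => ->.
by rewrite -natr1 mulrDl mul1r addrC EFinD; apply: leeD => //; exact: hc.
Qed.

Lemma law_given_originE A : mu [set w : config Gamma | w 1%g] != 0%E ->
  (law_given_origin mu A * mu [set w : config Gamma | w 1%g] =
   mu (A `&` [set w : config Gamma | w 1%g]))%E.
Proof.
move=> q0.
have fq : mu [set w : config Gamma | w 1%g] \is a fin_num.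
  by apply: fin_num_measure; exact: measurable_site.
rewrite -[law_given_origin mu A]/(mnormalize _ _ A) /mnormalize /= /mrestr setTI.
rewrite (negbTE q0) /=; case: ifPn => [/eqP qy|_]; first by rewrite qy in fq.
rewrite -[X in (_ * _ * X)%E](fineK fq) -muleA -EFinM mulVf ?mule1//.
by apply: contra q0 => /eqP h; rewrite -(fineK fq) h.
Qed.

Lemma degree_inE w x : (degree_in S w x)%:R = \sum_(y <- nbrs S x) (w y)%:R :> R.
Proof.
transitivity (\sum_(y <- nbrs S x | w y) 1 : R).
  rewrite big_fset_condE big_const_seq count_predT iter_addr_0.
  by rewrite /degree_in.
by rewrite big_mkcond; apply: eq_bigr => y _; case: (w y).
Qed.

Lemma mem_nbrs1 s : s \in S -> s != 1%g -> s \in nbrs S 1%g.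
Proof.
by move=> sS s1; apply/imfsetP; exists s; rewrite /= ?inE ?s1// mul1g.
Qed.

(** Condition on the event A that the cluster of 1 is in B. The degree of 1 has
    mean at least (1 - delta) d, as this event is in the sigma-field of the
    conditional expectation. So the mean number of neighbours of 1 outside the
    configuration is at most delta d, and the probability that s is one of them
    is at most that. *)
Lemma average_degree_separating (d : nat) (regS : regular_graph S d)
    (phi : config Gamma -> R) (delta : R) B s :
  average_degree S mu phi -> 0 <= delta <= 1 -> measurable B ->
  act_invariant shift_config B -> ~ B (fun=> false) ->
  (forall C, B C -> (1 - delta) * d%:R <= phi C) -> s \in S ->
  (intensity (separating B 1%g s) <=
   (delta * d%:R)%:E * mu [set w : config Gamma | B (clmap 1%g w)])%E.
Proof.
move=> [mphi _ [_ iphi avg]] /andP[d0 d1] mB Binv B0 hB sS.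
pose A := [set w : config Gamma | B (clmap 1%g w)].
have mA : measurable A by exact: measurable_clmap_set.
have A1 : A `<=` [set w : config Gamma | w 1%g].
  move=> w Aw /=; apply: contraT => w1; case: B0.
  rewrite (_ : (fun=> false) = clmap 1%g w)//; apply/funext => y.
  by rewrite /clmap /cluster_of (negbTE w1).
have sepE : intensity (separating B 1%g s) =
    mu [set w : config Gamma | A w /\ ~ clmap 1%g w s].
  have mBs : measurable (B `&` ~` [set C : config Gamma | C s]).
    by apply: measurableI => //; apply: measurableC; exact: measurable_site.
  rewrite (_ : separating B 1%g s = (B `&` ~` [set C : config Gamma | C s]) `&`
      [set C : config Gamma | C 1%g]); last first.
    by apply/seteqP; split => C; [move=> [? []]|move=> [[]]].
  rewrite intensity_site//; congr (mu _); apply/seteqP; split => w.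
    by move=> [[]].
  by move=> [Aw h]; split => //; exact: A1.
have [s1|s1] := eqVneq s 1%g.
  rewrite sepE s1 (_ : [set _ | _] = set0) ?measure0 ?mule_ge0//.
    by rewrite lee_fin mulr_ge0 ?ler0n.
  apply/seteqP; split => // w [Aw]; apply; apply: cl_refl; exact: A1.
have [A0|A0] := eqVneq (mu A) 0%E.
  rewrite [X in (_ * X)%E]A0 mule0 sepE -A0; apply: le_measure; rewrite ?inE//.
    rewrite (_ : [set _ | _] = A `&` ~` [set w : config Gamma | clmap 1%g w s]).
      apply: measurableI => //; apply: measurableC.
      exact: (measurable_clmap_set _ (measurable_site s)).
    by apply/seteqP; split.
  by move=> w [].
have q0 : mu [set w : config Gamma | w 1%g] != 0%E.
  apply: contra A0 => /eqP q0; rewrite eq_le measure_ge0 andbT -q0.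
  by apply: le_measure; rewrite ?inE//; exact: measurable_site.
have lawE D := law_given_originE D q0.
(* From here on the conditional law is a probability known through lawE. *)
move: (law_given_origin mu) => law in iphi avg lawE *.
have mlaw D : measurable D -> law D \is a fin_num by exact: fin_num_measure.
have I1 : (\int[law]_(w in A) (phi (clmap 1%g w))%:E =
           \int[law]_(w in A) ((degree_in S w 1%g)%:R)%:E)%E.
  apply: avg; apply: sub_sigma_algebra; exists B; split => //.
have I2 : (((1 - delta) * d%:R)%:E * law A <=
           \int[law]_(w in A) (phi (clmap 1%g w))%:E)%E.
  rewrite -integral_cst//; apply: ge0_le_integral => //.
  - by move=> w _; rewrite lee_fin mulr_ge0 ?ler0n// subr_ge0.
  - apply/measurable_EFinP; apply: (@measurable_funS _ _ _ _ setT) => //.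
    exact: (measurableT_comp mphi (measurable_clmap 1%g)).
  - by move=> w Aw; rewrite lee_fin; exact: hB.
have msite y : measurable [set w : config Gamma | w y] by exact: measurable_site.
have I3 : (\int[law]_(w in A) ((degree_in S w 1%g)%:R)%:E =
           \sum_(y <- nbrs S 1%g) law (A `&` [set w : config Gamma | w y]))%E.
  under eq_integral do rewrite degree_inE -sumEFin.
  rewrite ge0_integral_sum//.
  - apply: eq_bigr => y _.
    rewrite (eq_integral (fun w => (\1_[set w : config Gamma | w y] w)%:E)).
      by rewrite integral_indic// setIC.
    move=> w _; rewrite indicE; case: (boolP (w y)) => wy.
      by rewrite mem_set.
    by rewrite memNset//; exact/negP.
  - move=> y; apply/measurable_EFinP.
    rewrite (_ : (fun w : config Gamma => (w y)%:R) = \1_[set w : config Gamma | w y]).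
      exact: measurable_indic.
    apply/funext => w; rewrite indicE; case: (boolP (w y)) => wy.
      by rewrite mem_set.
    by rewrite memNset//; exact/negP.
(* All the neighbours other than s are bounded trivially. *)
have I4 : (\sum_(y <- nbrs S 1%g) law (A `&` [set w : config Gamma | w y]) <=
    (d%:R - 1)%:E * law A + law (A `&` [set w : config Gamma | w s]))%E.
  rewrite (big_fsetD1 s) /=; last exact: mem_nbrs1.
  rewrite addeC; apply: leeD => //.
  apply: le_trans (_ : \sum_(y <- (nbrs S 1%g `\ s)%fset) law A <= _)%E.
    apply: lee_sum => y _; apply: le_measure; rewrite ?inE//.
    exact: measurableI.
  have itE n (x : R) : iter n (+%E x%:E) 0%E = (n%:R * x)%:E.
    elim: n => [|n IH] /=; first by rewrite mul0r.
    by rewrite IH -EFinD -natr1 mulrDl mul1r addrC.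
  rewrite big_const_seq count_predT -(fineK (mlaw A mA)) itE -EFinM lee_fin.
  have := cardfsD1 s (nbrs S 1%g); rewrite (mem_nbrs1 sS s1) regS => ->.
  by rewrite natrD addrAC subrr add0r.
have AsE : (law (A `&` [set w : config Gamma | w s]) +
            law (A `&` ~` [set w : config Gamma | w s]) = law A)%E.
  rewrite -measureU//.
  - by rewrite -setIUr setUv setIT.
  - exact: measurableI.
  - by apply: measurableI => //; exact: measurableC.
  - by apply/seteqP; split => // w [[_ ws] [_ nws]].
have mAs : measurable (A `&` ~` [set w : config Gamma | w s]).
  by apply: measurableI => //; exact: measurableC.
have I5 : (law (A `&` ~` [set w : config Gamma | w s]) <=
           (delta * d%:R)%:E * law A)%E.
  have := I2; rewrite I1 I3 => /le_trans /(_ I4); rewrite -AsE.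
  rewrite -(fineK (mlaw _ (measurableI _ _ mA (msite s)))) -(fineK (mlaw _ mAs)).
  by rewrite -EFinD -!EFinM -EFinD !lee_fin; lra.
rewrite sepE; apply: (@le_trans _ _ (mu (A `&` ~` [set w : config Gamma | w s]))).
  apply: le_measure; rewrite ?inE//.
    rewrite (_ : [set _ | _] = A `&` ~` [set w : config Gamma | clmap 1%g w s]).
      apply: measurableI => //; apply: measurableC.
      exact: (measurable_clmap_set _ (measurable_site s)).
    by apply/seteqP; split.
  move=> w [Aw ns]; split => // ws; apply: ns.
  by apply: cl_adj => //; [exact: A1|exact: mem_nbrs1].
have E D : D `<=` A -> mu D = (law D * mu [set w : config Gamma | w 1%g])%E.
  by move=> DA; rewrite lawE setIidl//; exact: subset_trans A1.
rewrite [leLHS](E _ (@subIsetl _ _ _)) -/A [X in (_ <= _ * X)%E](E A)// muleA.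
by apply: lee_wpmul2r.
Qed.

End intensity.

(** * At most one good cluster *)
Section unique_cluster.
Context (R : realType) (Gamma : groupType) (S : {fset Gamma}).
Hypotheses (symS : symmetric_set S) (genS : generating_set S).
Variable e : nat -> Gamma.
Hypothesis esurj : forall g, exists n, e n = g.
Variables (Q : {fset Gamma}) (eps : R).
Hypotheses (eps_gt0 : 0 < eps) (kp : kazhdan_pair Q eps).
Variable mu : probability (config Gamma) R.
Local Notation shift := (translate (@lmul Gamma)).
Local Notation shift_config := (shift : Gamma -> config Gamma -> config Gamma).
Hypothesis inv : site_percolation_law mu.
Hypothesis erg : act_ergodic mu shift_config.
Local Notation m := (intensity S e mu).
Local Notation cl := (@clmap Gamma S).
Implicit Types (w C : config Gamma) (x y z g : Gamma) (B : set (config Gamma)).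

Definition root_density B := mu [set w : config Gamma | B (cl 1%g w)].

(** G is the set of good clusters. It is invariant and avoids the empty
    configuration, which is the cluster of a vertex outside of X. The hypothesis
    separation says that, for invariant sets of good clusters, the clusters
    through 1 and through g nearly coincide. *)
Variable G : set (config Gamma).
Hypothesis mG : measurable G.
Hypothesis Ginv : act_invariant shift_config G.
Hypothesis G0 : ~ G (fun=> false).
Variable c : R.
Hypothesis separation : forall B, measurable B -> act_invariant shift_config B ->
  B `<=` G -> forall g, g \in Q ->
  (m (separating B 1%g g) + m (separating B g 1%g) <= c%:E * root_density B)%E.
Hypothesis c_eps : c < eps ^+ 2.
Hypothesis cQ_eps : (size Q)%:R * c < eps ^+ 2 / 2.

Lemma root_density_fin B : measurable B -> root_density B \is a fin_num.
Proof. by move=> mB; apply: fin_num_measure; exact: measurable_clmap_set. Qed.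

Lemma cl_nonempty B x w : B `<=` G -> B (cl x w) -> w x.
Proof.
move=> BG Bx; apply: contraT => wx; case: G0; have := BG _ Bx.
rewrite (_ : cl x w = (fun=> false))//; apply/funext => y.
by rewrite /clmap /cluster_of (negbTE wx).
Qed.

Lemma intensity_root B : measurable B -> B `<=` G ->
  m (B `&` [set C : config Gamma | C 1%g]) = root_density B.
Proof.
move=> mB BG; rewrite intensity_site//; congr (mu _); apply/seteqP; split => w.
  by case.
by move=> Bw; split => //; exact: cl_nonempty BG Bw.
Qed.

Lemma intensity_root_shift B x : measurable B -> act_invariant shift_config B ->
  m (B `&` [set C : config Gamma | C x]) = m (B `&` [set C : config Gamma | C 1%g]).
Proof.
move=> mB Binv; rewrite -[LHS](intensity_shift symS esurj inv x); last first.
  by apply: measurableI => //; exact: measurable_site.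
have sE (C : config Gamma) : shift x C x = C 1%g.
  by rewrite -{2}(mulg1 x) -/(lmul x 1%g) shiftE.
congr (m _); apply/seteqP; split => C.
  by move=> [BC]; rewrite /= sE => h; split => //; apply/(Binv x).
by move=> [BC h]; split; [apply/(Binv x)|rewrite /= sE].
Qed.

Lemma intensity_null B : measurable B -> act_invariant shift_config B ->
  B `<=` G -> root_density B = 0%E -> m B = 0%E.
Proof.
move=> mB Binv BG B0; apply: intensity_eq0 => // x.
by rewrite intensity_root_shift// intensity_root.
Qed.

(** The same set seen from the vertex x, as an event for the percolation. *)
Lemma separatingE B x y : measurable B ->
  m (separating B x y) =
  mu [set w : config Gamma | [/\ B (cl x w), w x & ~ cl x w y]].
Proof.
move=> mB; have mBy : measurable (B `&` ~` [set C : config Gamma | C y]).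
  by apply: measurableI => //; apply: measurableC; exact: measurable_site.
rewrite (_ : separating B x y = (B `&` ~` [set C : config Gamma | C y]) `&`
    [set C : config Gamma | C x]); last first.
  by apply/seteqP; split => C; [move=> [? []]|move=> [[]]].
rewrite intensity_site//; congr (mu _); apply/seteqP; split => w.
  by move=> [[]].
by move=> [].
Qed.

(** The clusters of 1 and of g are either equal or separate 1 from g, so the event
    that the cluster of 1 is in B is almost invariant, with an error that is
    small relative to its probability p. The spectral gap then bounds
    eps^2 p (1 - p) by (size Q) c p, which is less than eps^2 p / 2. *)
Lemma root_density_half B : measurable B -> act_invariant shift_config B ->
  B `<=` G -> root_density B != 0%E -> 1 / 2 < fine (root_density B).
Proof.
move=> mB Binv BG B0.
set E := [set w : config Gamma | B (cl 1%g w)].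
have mE : measurable E by exact: measurable_clmap_set.
have := percolation_spectral_gap symS genS eps_gt0 kp inv erg mE.
have fp : root_density B = (fine (root_density B))%:E.
  by rewrite fineK// root_density_fin.
set p := fine (root_density B) in fp *.
have p0 : 0 < p.
  rewrite lt_neqAle fine_ge0// andbT; apply/eqP => p0.
  by move: B0; rewrite fp -p0 eqxx.
have -> : fine (mu (~` E)) = 1 - p.
  by rewrite probability_setC// fineB// ?fin_num_measure.
have bound g : g \in Q ->
    fine (mu ((shift_config g^-1%g @^-1` E) `+` E)) <= c * p.
  move=> gQ; have msE : measurable (shift_config g^-1%g @^-1` E).
    by rewrite -[X in measurable X]setTI; exact: measurable_shift.
  rewrite -lee_fin EFinM -fp fineK; last first.
    by apply: fin_num_measure; exact: measurable_setY.
  apply: le_trans (separation mB Binv BG gQ).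
  rewrite !separatingE//.
  have mset x y : measurable
      [set w : config Gamma | [/\ B (cl x w), w x & ~ cl x w y]].
    rewrite (_ : [set _ | _] = [set w : config Gamma | B (cl x w)] `&`
       ([set w : config Gamma | w x] `&` ~` [set w : config Gamma | cl x w y])).
      apply: measurableI; first exact: measurable_clmap_set.
      apply: measurableI; first exact: measurable_site.
      apply: measurableC.
      exact: (@measurable_clmap_set _ S x _ (measurable_site y)).
    by apply/seteqP; split => w; [move=> []|move=> [? []]].
  apply: le_trans (measureU2 _ (mset 1%g g) (mset g 1%g)).
  have gE w : (shift_config g^-1%g @^-1` E) w <-> B (cl g w).
    rewrite /E /= /clmap -{1}(mulVg g) -/(lmul g^-1%g g) cl_shift.
    exact: Binv.
  apply: le_measure; rewrite ?inE.
  - exact: measurable_setY.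
  - exact: measurableU.
  move=> w [[/gE Bg nB1]|[B1 nBg]].
    right; split => //; first exact: cl_nonempty BG Bg.
    by move=> /(cl_eq symS) eg; apply: nB1; rewrite /E /= /clmap -eg.
  left; split => //; first exact: cl_nonempty BG B1.
  by move=> /(cl_eq symS) eg; apply: nBg; apply/gE; rewrite /clmap -eg.
move=> gap.
have : eps ^+ 2 * (p * (1 - p)) <= (size Q)%:R * (c * p).
  apply: le_trans gap _; apply: le_trans (_ : \sum_(g <- Q) (c * p) <= _).
    by rewrite big_seq [leRHS]big_seq; apply: ler_sum => g gQ; exact: bound.
  by rewrite big_const_seq count_predT iter_addr_0 mulr_natl.
rewrite [p * _]mulrC !mulrA ler_pM2r// => h.
have : eps ^+ 2 * (1 - p) < eps ^+ 2 * (1 / 2).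
  by apply: le_lt_trans h _; rewrite mul1r.
by rewrite ltr_pM2l ?exprn_gt0//; lra.
Qed.

Definition good_intensity : {measure set (config Gamma) -> \bar R} := mrestr m mG.

Lemma good_intensityE B : good_intensity B = m (B `&` G).
Proof. by []. Qed.

Lemma good_intensity_shift g B : measurable B ->
  good_intensity (shift_config g @^-1` B) = good_intensity B.
Proof.
move=> mB; rewrite !good_intensityE -[RHS](intensity_shift symS esurj inv g); last first.
  exact: measurableI.
congr (m _); apply/seteqP; split => C [BC GC]; split => //; first by apply/(Ginv g).
by move: GC => /(Ginv g).
Qed.

Definition rooted : set (config Gamma) := [set C : config Gamma | C 1%g].

Lemma measurable_rooted : measurable rooted.
Proof. exact: measurable_site. Qed.

Lemma good_intensity_rooted : good_intensity rooted = root_density G.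
Proof. by rewrite good_intensityE setIC intensity_root. Qed.

Lemma rooted_boundary g : g \in Q ->
  (good_intensity ((shift_config g^-1%g @^-1` rooted) `+` rooted) <=
   c%:E * root_density G)%E.
Proof.
move=> gQ; rewrite good_intensityE; apply: le_trans (separation mG Ginv (@subset_refl _ G) gQ).
have ms x y : measurable (separating G x y) by exact: measurable_separating.
apply: le_trans (measureU2 _ (ms 1%g g) (ms g 1%g)).
have gE C : (shift_config g^-1%g @^-1` rooted) C <-> C g.
  by rewrite /rooted /= /translate /lmul invgK mulg1.
have mgE : measurable (shift_config g^-1%g @^-1` rooted).
  by rewrite -[X in measurable X]setTI; exact: (measurable_shift g^-1%g) measurable_rooted.
apply: le_measure; rewrite ?inE.
- by apply: measurableI => //; apply: measurable_setY => //; exact: measurable_rooted.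
- exact: measurableU.
move=> C [[[/gE Cg nC1]|[C1 nCg]] GC]; first by right.
by left; split => //; split => // Cg; apply: nCg; apply/gE.
Qed.

Lemma invariantI A B : act_invariant shift_config A -> act_invariant shift_config B ->
  act_invariant shift_config (A `&` B).
Proof.
by move=> hA hB g C; rewrite /setI /= (propext (hA g C)) (propext (hB g C)).
Qed.

Lemma invariantC A : act_invariant shift_config A -> act_invariant shift_config (~` A).
Proof. by move=> hA g C; rewrite /setC /= (propext (hA g C)). Qed.

(** Otherwise the cluster of 1 would be in A with probability above 1/2, and in B
    with probability above 1/2. *)
Lemma invariant_dichotomy A B : measurable A -> measurable B ->
  act_invariant shift_config A -> act_invariant shift_config B ->
  A `<=` G -> B `<=` G -> A `&` B = set0 -> m A = 0%E \/ m B = 0%E.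
Proof.
move=> mA mB Ai Bi AG BG AB.
have [A0|A0] := eqVneq (root_density A) 0%E; first by left; exact: intensity_null.
have [B0|B0] := eqVneq (root_density B) 0%E; first by right; exact: intensity_null.
have hA := root_density_half mA Ai AG A0; have hB := root_density_half mB Bi BG B0.
have : (root_density A + root_density B <= 1)%E.
  have mcA := @measurable_clmap_set _ S 1%g _ mA.
  have mcB := @measurable_clmap_set _ S 1%g _ mB.
  rewrite /root_density -measureU//; first exact: probability_le1 (measurableU _ _ mcA mcB).
  apply/seteqP; split => // w [Aw Bw].
  by have : (A `&` B) (cl 1%g w) by []; rewrite AB.
rewrite -(fineK (root_density_fin mA)) -(fineK (root_density_fin mB)) -EFinD lee_fin.
by move=> h; have := lt_le_trans (ltrD hA hB) h; rewrite -splitr ltxx.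
Qed.

(** The clusters through 1 are almost invariant for the intensity, whence an
    invariant set A of positive finite intensity. By the dichotomy the good
    clusters outside of A are negligible. *)
Lemma good_intensity_finite : (m G < +oo)%E.
Proof.
have [p0|p0] := eqVneq (root_density G) 0%E; first by rewrite intensity_null.
have pfin := root_density_fin mG.
have [||||A [mA Ainv]] := @kazhdan_invariant_set _ _ _ good_intensity _ shift_config
  (@shift1 Gamma) (@shiftM Gamma) (@measurable_shift Gamma) good_intensity_shift
  e esurj Q eps rooted eps_gt0 kp.
- exact: measurable_rooted.
- by rewrite good_intensity_rooted lt_neqAle eq_sym p0 measure_ge0.
- by rewrite good_intensity_rooted -ge0_fin_numE.
- move=> g gQ; apply: le_lt_trans (rooted_boundary gQ) _.
  rewrite good_intensity_rooted -(fineK pfin) -!EFinM lte_fin ltr_pM2r//.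
  by rewrite fine_gt0// lt_neqAle eq_sym p0 measure_ge0 /= -ge0_fin_numE.
rewrite !good_intensityE => A0 Afin.
have mAG : measurable (A `&` G) by exact: measurableI.
have mDG : measurable (~` A `&` G) by apply: measurableI => //; exact: measurableC.
have AD : (A `&` G) `&` (~` A `&` G) = set0 by rewrite setIACA setICr set0I.
have [h|h] := invariant_dichotomy mAG mDG (invariantI Ainv Ginv)
  (invariantI (invariantC Ainv) Ginv) (@subIsetr _ A G) (@subIsetr _ (~` A) G) AD.
  by rewrite h ltxx in A0.
have -> : G = (A `&` G) `|` (~` A `&` G) by rewrite -setIUl setUv setTI.
by rewrite measureU// [X in (_ + X)%E]h adde0.
Qed.

Lemma good_intensity_ergodic : act_ergodic good_intensity shift_config.
Proof.
move=> A mA Ainv; rewrite !good_intensityE.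
apply: invariant_dichotomy.
- exact: measurableI.
- by apply: measurableI => //; exact: measurableC.
- exact: invariantI.
- by apply: invariantI => //; exact: invariantC.
- exact: subIsetr.
- exact: subIsetr.
- by rewrite setIACA setICr set0I.
Qed.

(** The spectral gap for the clusters through 1, whose intensity is p, reads
    eps^2 p (K - p) <= K (size Q) c p with K = m G. Hence K - p < K / 2. *)
Lemma good_intensity_lt2 : (m G < 2%:E)%E.
Proof.
have [p0|p0] := eqVneq (root_density G) 0%E.
  by rewrite intensity_null// lte_fin.
have pfin := root_density_fin mG.
have TE : good_intensity setT = m G by rewrite good_intensityE setTI.
have mfin : m G \is a fin_num by rewrite ge0_fin_numE// good_intensity_finite.
have fin B : measurable B -> good_intensity B \is a fin_num.
  move=> mB; rewrite ge0_fin_numE//; apply: le_lt_trans good_intensity_finite.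
  rewrite -TE; apply: le_measure; rewrite ?inE//.
have Tfin : (good_intensity setT < +oo)%E by rewrite TE good_intensity_finite.
have := @spectral_gap _ _ _ good_intensity _ shift_config
  (@shift1 Gamma) (@shiftM Gamma) (@measurable_shift Gamma) good_intensity_shift
  e esurj Q eps rooted eps_gt0 kp Tfin good_intensity_ergodic measurable_rooted.
set K := fine (m G); set p := fine (root_density G).
have KE : m G = K%:E by rewrite fineK.
have pE : root_density G = p%:E by rewrite fineK.
have p0' : 0 < p.
  by rewrite fine_gt0// lt_neqAle eq_sym p0 measure_ge0 /= -ge0_fin_numE.
have p1 : p <= 1 by rewrite -lee_fin -pE probability_le1//; exact: measurable_clmap_set.
have pK : p <= K.
  rewrite -lee_fin -pE -KE -good_intensity_rooted -TE.
  by apply: le_measure; rewrite ?inE//; exact: measurable_rooted.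
have -> : fine (good_intensity setT) = K by rewrite TE.
have -> : fine (good_intensity rooted) = p by rewrite good_intensity_rooted.
have -> : fine (good_intensity (~` rooted)) = K - p.
  have mR := measurable_rooted.
  have -> : K = fine (good_intensity rooted + good_intensity (~` rooted))%E.
    rewrite -measureU; [|by []|exact: measurableC|].
      by rewrite setUv -[RHS]/(fine (good_intensity setT)) TE.
    by rewrite setICr.
  rewrite good_intensity_rooted fineD ?fin//; last exact: measurableC.
  by rewrite -/p addrAC subrr add0r.
have bound g : g \in Q ->
    fine (good_intensity ((shift_config g^-1%g @^-1` rooted) `+` rooted)) <= c * p.
  move=> gQ; rewrite -lee_fin EFinM -pE fineK; first exact: rooted_boundary.
  apply: fin; apply: measurable_setY; last exact: measurable_rooted.
  by rewrite -[X in measurable X]setTI; exact: (measurable_shift g^-1%g) measurable_rooted.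
move=> gap; have : eps ^+ 2 * (p * (K - p)) <= K * ((size Q)%:R * (c * p)).
  apply: le_trans gap _; rewrite ler_pM2l ?(lt_le_trans p0')//.
  apply: le_trans (_ : \sum_(g <- Q) (c * p) <= _).
    by rewrite big_seq [leRHS]big_seq; apply: ler_sum => g gQ; exact: bound.
  by rewrite big_const_seq count_predT iter_addr_0 mulr_natl.
rewrite [p * _]mulrC !mulrA ler_pM2r// -mulrA => h.
have : eps ^+ 2 * (K - p) < eps ^+ 2 * (K / 2).
  apply: le_lt_trans h _; rewrite [ltRHS]mulrA [_ * K]mulrC -mulrA.
  by rewrite ltr_pM2l// (lt_le_trans p0').
rewrite ltr_pM2l ?exprn_gt0// KE lte_fin => h2.
by lra.
Qed.

Definition two_good_clusters : set (config Gamma) :=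
  [set w : config Gamma | exists x y, [/\ G (cl x w), G (cl y w) & ~ cl x w y]].

Lemma measurable_two_good_clusters : measurable two_good_clusters.
Proof.
rewrite (_ : two_good_clusters = \bigcup_n \bigcup_k
  ([set w : config Gamma | G (cl (e n) w)] `&` ([set w : config Gamma | G (cl (e k) w)] `&`
    ~` [set w : config Gamma | cl (e n) w (e k)]))).
  apply: bigcupT_measurable => n; apply: bigcupT_measurable => k.
  apply: measurableI; first exact: measurable_clmap_set.
  apply: measurableI; first exact: measurable_clmap_set.
  apply: measurableC.
  exact: (@measurable_clmap_set _ S (e n) _ (measurable_site (e k))).
apply/seteqP; split => w.
  move=> [x [y [Gx Gy xy]]]; have [n en] := esurj x; have [k ek] := esurj y.
  by exists n => //; exists k => //; rewrite en ek.
by move=> [n _ [k _ [Gx [Gy xy]]]]; exists (e n), (e k).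
Qed.

Lemma two_good_clusters_invariant : act_invariant shift_config two_good_clusters.
Proof.
have sub g w : two_good_clusters w -> two_good_clusters (shift g w).
  move=> [x [y [Gx Gy xy]]]; exists (lmul g x), (lmul g y).
  by rewrite /clmap !cl_shift shiftE; split => //; apply/(Ginv g).
move=> g w; split; last exact: sub.
by move=> /(sub g^-1%g); rewrite -shiftM mulVg shift1.
Qed.

(** If this invariant event had probability one, the expected number of good
    clusters would be at least two. *)
Lemma two_good_clusters_null : mu two_good_clusters = 0%E.
Proof.
have mW := measurable_two_good_clusters.
have [//|W1] := erg mW two_good_clusters_invariant.
have := good_intensity_lt2; rewrite ltNge => /negP[].
have muW : mu two_good_clusters = 1%E.
  rewrite -[two_good_clusters]setCK probability_setC ?[X in (1 - X)%E]W1 ?sube0//.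
  exact: measurableC.
rewrite -(integral_cluster_count symS esurj)//.
apply: (@le_trans _ _ (\int[mu]_(w in two_good_clusters) 2%:E)%E).
  by rewrite integral_cst// [X in (_ * X)%E]muW mule1.
apply: le_trans (_ : \int[mu]_(w in two_good_clusters) cluster_count R S G w <= _)%E.
  apply: ge0_le_integral => //.
    apply: (@measurable_funS _ _ _ _ setT) => //.
    exact: (measurable_cluster_count symS esurj).
  move=> w [x [y [Gx Gy xy]]].
  have wx : w x by exact: cl_nonempty (@subset_refl _ G) Gx.
  have wy : w y by exact: cl_nonempty (@subset_refl _ G) Gy.
  apply: (@cluster_count_ge2 R _ S G w (cl x w) (cl y w)) => //.
  - by move=> h; apply: xy; rewrite h; exact: cl_refl.
  - by exists x.
  - by exists y.
apply: ge0_subset_integral => //; first exact: (measurable_cluster_count symS esurj).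
by move=> w _; exact: esum_ge0.
Qed.

End unique_cluster.

(** * Infinite clusters of large average degree *)
Section infinite_clusters.
Context (Gamma : groupType) (e : nat -> Gamma).
Hypothesis esurj : forall g, exists n, e n = g.
Local Notation shift := (translate (@lmul Gamma)).
Local Notation shift_config := (shift : Gamma -> config Gamma -> config Gamma).

Definition infinite_config : set (config Gamma) :=
  [set C : config Gamma | infinite_set [set x | C x]].

Lemma finite_set_enumeration (A : set Gamma) :
  finite_set A <-> exists k, A `<=` e @` `I_k.
Proof.
split; last first.
  by move=> [k] /sub_finite_set; apply; apply: finite_image; exact: finite_II.
move=> /finite_seqP[s ->].
have [f fP] := choice esurj.
exists (\max_(x <- s) f x).+1 => x /= xs; exists (f x) => //=.
by rewrite ltnS (big_rem x)//= leq_maxl.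
Qed.

Lemma measurable_infinite_config : measurable infinite_config.
Proof.
rewrite (_ : infinite_config = ~` \bigcup_k \bigcap_n
  [set C : config Gamma | C (e n) -> (e @` `I_k) (e n)]); last first.
  apply/seteqP; split => C.
    move=> hC [k _ hk]; apply: hC; apply/finite_set_enumeration; exists k => x Cx.
    by have [n en] := esurj x; move: Cx; rewrite /= -en => /(hk n I).
  move=> hC /finite_set_enumeration[k hk]; apply: hC; exists k => // n _ /=.
  exact: hk.
apply: measurableC; apply: bigcupT_measurable => k.
apply: bigcapT_measurable => n.
have [en|en] := pselect ((e @` `I_k) (e n)).
  by rewrite (_ : [set _ | _] = setT)//; apply/seteqP; split => // C _ _.
rewrite (_ : [set _ | _] = ~` [set C : config Gamma | C (e n)]).
  by apply: measurableC; exact: measurable_site.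
by apply/seteqP; split => C /= hC => [/hC|/hC[]].
Qed.

Lemma infinite_config_invariant : act_invariant shift_config infinite_config.
Proof.
have sub g (C : config Gamma) : finite_set [set x | C x] ->
    finite_set [set x | shift g C x].
  move=> /(finite_image (lmul g)); apply: sub_finite_set => x /= Cx.
  by exists (g^-1 * x)%g => //; rewrite /lmul mulVKg.
move=> g C; split; rewrite /infinite_config /=; apply: contra_not; first exact: sub.
by move=> /(sub g^-1%g); rewrite -shiftM mulVg shift1.
Qed.

End infinite_clusters.

(** The choice of delta for a Kazhdan pair (Q, eps) with n = size Q, where L
    bounds the length of words for each g in Q together with its inverse. *)
Lemma density_defect_exists (R : realType) (eps : R) (L n d : nat) : 0 < eps ->
  exists delta : R, [/\ 0 < delta, delta <= 1,
    L%:R * (delta * d%:R) < eps ^+ 2 &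
    n%:R * (L%:R * (delta * d%:R)) < eps ^+ 2 / 2].
Proof.
move=> eps0; have e0 : 0 < eps ^+ 2 by rewrite exprn_gt0.
have : exists2 K : R, 1 <= K & (L * d)%:R <= K /\ (n * (L * d))%:R <= K.
  exists (1 + (L * d) + n * (L * d))%:R; first by rewrite ler1n.
  by rewrite !ler_nat; split; rewrite ?leq_addl// -addnA addnCA leq_addr.
move=> [K K1 [K2 K3]].
have K0 : 0 < K by exact: lt_le_trans K1.
pose delta := eps ^+ 2 / (2 * (1 + eps ^+ 2)) / K.
have dK : delta * K < eps ^+ 2 / 2.
  rewrite /delta divfK ?gt_eqF// invfM mulrA ltr_pdivrMr ?addr_gt0//.
  by rewrite ltr_pMr ?divr_gt0// ltrDl.
have d0 : 0 < delta by rewrite /delta !divr_gt0// mulr_gt0// addr_gt0.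
exists delta; split => //.
- apply: le_trans (_ : delta * K <= 1); first by rewrite ler_pMr.
  rewrite /delta divfK ?gt_eqF// ler_pdivrMr ?mulr_gt0 ?addr_gt0// mul1r.
  rewrite mulrDr mulr1; apply: le_trans (_ : 2 * eps ^+ 2 <= _).
    by rewrite ler_peMl ?ler1n// ltW.
  by rewrite lerDr.
- apply: le_lt_trans (_ : delta * K < _); last first.
    by apply: lt_trans dK _; rewrite ltr_pdivrMr// ltr_pMr// ltr1n.
  by rewrite mulrCA -natrM ler_pM2l.
- apply: le_lt_trans dK.
  by rewrite [L%:R * _]mulrCA [n%:R * _]mulrCA -!natrM ler_pM2l.
Qed.

Theorem corollary1p8 (R : realType) (Gamma : groupType) (S : {fset Gamma})
  (d : nat)
  (infGamma : infinite_set [set: Gamma])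
  (kazhdan : property_T R Gamma)
  (symS : symmetric_set S) (genS : generating_set S)
  (regS : regular_graph S d) :
  exists delta : R, 0 < delta /\
    forall (disp : measure_display) (Omega : measurableType disp)
      (P : probability Omega R) (X : {RV P >-> config Gamma}),
      site_percolation_law (distribution P X) ->
      fiid_law S (distribution P X) \/ weak_fiid_law S (distribution P X) ->
      forall phi : config Gamma -> R,
        average_degree S (distribution P X) phi ->
        {ae P, forall w : Omega, forall C1 C2 : config Gamma,
          infinite_cluster S (X w) C1 -> (1 - delta) * d%:R <= phi C1 ->
          infinite_cluster S (X w) C2 -> (1 - delta) * d%:R <= phi C2 ->
          C1 = C2}.
Proof.
move: kazhdan => [Q [eps [eps_gt0 kp]]].
have [e esurj] := enumeration_exists symS genS.
have [word wordP] : {word : Gamma -> seq Gamma & forall g,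
    all (fun s => s \in S) (word g) /\ g = word_value (word g)}.
  apply: (@choice _ _ (fun g t => all (fun s => s \in S) t /\ g = word_value t)) => g.
  by have [t] := word_exists symS genS g; exists t.
pose len g := size (word g).
pose L := (\sum_(g <- Q) (len g + len g^-1%g))%N.
have [delta [delta_gt0 delta_le1 c_eps cQ_eps]] :=
  density_defect_exists L (size Q) d eps_gt0.
exists delta; split => // disp Omega P X inv law phi avg.
pose mu : probability (config Gamma) R := distribution P X.
have [mphi phi_shift _] := avg.
pose G : set (config Gamma) :=
  [set C : config Gamma | (1 - delta) * d%:R <= phi C] `&` @infinite_config Gamma.
have mG : measurable G.
  apply: measurableI; last exact: measurable_infinite_config esurj.
  rewrite (_ : [set _ | _] = phi @^-1` `[(1 - delta) * d%:R, +oo[%classic).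
    by rewrite -[X in measurable X]setTI; exact: mphi.
  by apply/seteqP; split => C /=; rewrite in_itv/= andbT.
have Ginv : act_invariant (translate (@lmul Gamma) : Gamma -> config Gamma -> config Gamma) G.
  move=> g C; rewrite /G /setI /= phi_shift.
  by rewrite (propext (infinite_config_invariant g C)).
have G0 : ~ G (fun=> false).
  move=> [_ /=]; apply; rewrite (_ : [set _ | _] = set0)//.
  by apply/seteqP; split.
have erg := fiid_or_weak_ergodic infGamma symS genS eps_gt0 kp inv law.
have null : mu (two_good_clusters S G) = 0%E.
  apply: (two_good_clusters_null symS genS esurj eps_gt0 kp inv erg mG Ginv G0 _
    c_eps cQ_eps) => B mB Binv BG g gQ.
  have B0 : ~ B (fun=> false) by move=> /BG.
  have pfin : root_density S mu B \is a fin_num by exact: root_density_fin.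
  have step s : s \in S -> (intensity S e mu (separating B 1%g s) <=
      (delta * d%:R * fine (root_density S mu B))%:E)%E.
    rewrite EFinM fineK//.
    apply: (average_degree_separating symS esurj regS avg) => //.
      by rewrite ltW.
    by move=> C /BG[].
  have hword h : (intensity S e mu (separating B 1%g h) <=
      ((len h)%:R * (delta * d%:R * fine (root_density S mu B)))%:E)%E.
    have [wS hE] := wordP h; rewrite {1}hE.
    exact: (intensity_separating_word symS esurj inv).
  have -> : intensity S e mu (separating B g 1%g) =
      intensity S e mu (separating B 1%g g^-1%g).
    have := intensity_separating_shift symS esurj inv g 1%g g^-1%g mB Binv.
    by rewrite mulg1 mulgV.
  apply: le_trans (leeD (hword g) (hword g^-1%g)) _.
  rewrite -[X in (_ <= _ * X)%E](fineK pfin) -EFinM -EFinD lee_fin -mulrDl -natrD -[leRHS]mulrA.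
  apply: ler_wpM2r.
    by apply: mulr_ge0; [apply: mulr_ge0 => //; exact: ltW|rewrite fine_ge0// measure_ge0].
  by rewrite ler_nat /L (big_rem g)//= leq_addr.
exists (X @^-1` two_good_clusters S G); split => //.
  rewrite -[X in measurable X]setTI; apply: measurable_funP => //.
  exact: measurable_two_good_clusters.
move=> w; apply: contra_notP => nW C1 C2 [[x [Xx ->]] inf1] h1 [[y [Xy ->]] inf2] h2.
apply: (cl_eq symS); apply: contrapT => xy; apply: nW.
by exists x, y.
Qed.
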